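(* Let $\mathcal{T}=(\mathcal{V},\mathcal{E})$ be a tree with $\mathcal{V}=\{1,\dots,d\}$, let $(\boldsymbol{\lambda},\boldsymbol{\alpha})$ be admissible parameters, and let $\boldsymbol{N}=(N_v)_{v\in\mathcal{V}}\sim\mathrm{MPMRF}(\boldsymbol{\lambda},\boldsymbol{\alpha},\mathcal{T})$. Let $X_v=\sum_{j=1}^{N_v}B_{v,j}$ for $v\in\mathcal{V}$ and $S=\sum_{v\in\mathcal{V}}X_v$, where for each $v$ the $\mathbb{N}$-valued variables $B_{v,1},B_{v,2},\dots$ are i.i.d. copies of $B_v$ with $0<\mathbb{E}[B_v]<\infty$, the sequences for different $v$ are mutually independent, and all are independent of $\boldsymbol{N}$. Then for every $v\in\mathcal{V}$, the ordinary generating function of expected allocations $\mathcal{P}_S^{[v]}(t)=\sum_{k=0}^{\infty}\mathbb{E}[X_v\mathbf{1}_{\{S=k\}}]\,t^k$ is given by $$\mathcal{P}_S^{[v]}(t)=\lambda_v\,\mathbb{E}[B_v]\;\eta_v^{\mathcal{T}_v}\big(\boldsymbol{s}(t);\boldsymbol{\theta}\big)\;\mathcal{P}_S(t),\qquad t\in[-1,1],$$ where $\mathcal{T}_v$ is $\mathcal{T}$ rooted at $v$; $\boldsymbol{s}(t)=(s_j(t))_{j\in\mathcal{V}}$ with $s_v(t)=\dfrac{t\,\frac{\mathrm{d}}{\mathrm{d}t}\mathcal{P}_{B_v}(t)}{\mathbb{E}[B_v]}$ and $s_j(t)=\mathcal{P}_{B_j}(t)$ for $j\neq v$; $\boldsymbol{\theta}=(\theta_k)_{k\in\mathcal{V}\setminus\{v\}}$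 with $\theta_k=\alpha_{(\mathrm{pa}(k),k)}\sqrt{\lambda_k/\lambda_{\mathrm{pa}(k)}}$, parents being taken in $\mathcal{T}_v$; and $\mathcal{P}_Z(t)=\mathbb{E}[t^Z]$ denotes the probability generating function of $Z$.
   Context: Edges are undirected, so $\alpha_{(u,v)}=\alpha_{(v,u)}$. Parameters $(\boldsymbol{\lambda},\boldsymbol{\alpha})$, with $\boldsymbol{\lambda}=(\lambda_v)_{v\in\mathcal{V}}$ and $\boldsymbol{\alpha}=(\alpha_e)_{e\in\mathcal{E}}$, are admissible if $\lambda_v>0$ for all $v$ and $0<\alpha_{(u,v)}\le\min(\sqrt{\lambda_u/\lambda_v},\sqrt{\lambda_v/\lambda_u})$ for every edge $(u,v)$. Binomial thinning: for an $\mathbb{N}$-valued $Y$ and $\theta\in[0,1]$, $\theta\circ Y:=\sum_{j=1}^{Y}I_j^{(\theta)}$ with $(I_j^{(\theta)})_{j\ge1}$ i.i.d. Bernoulli($\theta$), independent of $Y$. $\boldsymbol{N}\sim\mathrm{MPMRF}(\boldsymbol{\lambda},\boldsymbol{\alpha},\mathcal{T})$ means: for a choice of root $r\in\mathcal{V}$ (the resulting law does not depend on the choice), with $\mathrm{pa}(v)$ the parent of $v$ in $\mathcal{T}$ rooted at $r$, $N_r=L_r$ and $N_v=\big(\alpha_{(\mathrm{pa}(v),v)}\sqrt{\lambda_v/\lambda_{\mathrm{pa}(v)}}\big)\circ N_{\mathrm{pa}(v)}+L_v$ for $v\ne r$, where the $L_v$ are independent, $L_r\sim\mathrm{Poisson}(\lambda_r)$,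 $L_v\sim\mathrm{Poisson}\big(\lambda_v(1-\alpha_{(\mathrm{pa}(v),v)}\sqrt{\lambda_{\mathrm{pa}(v)}/\lambda_v})\big)$ for $v\neq r$, and the Bernoulli sequences used in the thinnings are mutually independent and independent of $(L_v)_{v\in\mathcal{V}}$. A Poisson distribution with parameter $0$ is the point mass at $0$; empty sums are $0$ and empty products are $1$. For a rooted tree $\mathcal{T}_r$, let $\mathrm{ch}(v)$ and $\mathrm{dsc}(v)$ denote the children and the (proper) descendants of $v$. For $\boldsymbol{t}\in[-1,1]^d$ and thinning parameters $\theta_j\in[0,1]$, the functions $\eta_v^{\mathcal{T}_r}$ are defined recursively by $$\eta_v^{\mathcal{T}_r}\big((t_j)_{j\in\{v\}\cup\mathrm{dsc}(v)};(\theta_j)_{j\in\mathrm{dsc}(v)}\big)=t_v\prod_{j\in\mathrm{ch}(v)}\Big(1-\theta_j+\theta_j\,\eta_j^{\mathcal{T}_r}\big((t_i)_{i\in\{j\}\cup\mathrm{dsc}(j)};(\theta_i)_{i\in\mathrm{dsc}(j)}\big)\Big),$$ so that $\eta_v^{\mathcal{T}_r}=t_v$ when $v$ has no children. The expression $t\frac{\mathrm{d}}{\mathrm{d}t}\mathcal{P}_{B_v}(t)$ is understood as the power series $\sum_{k\ge1}k\Pr(B_v=k)t^k$ (including at $t=\pm1$). *)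

(* Defs.v *)
From HB Require Import structures.
From mathcomp Require Import all_boot all_order all_algebra.
From mathcomp Require Import finmap zify.
From mathcomp Require Import all_classical all_reals all_analysis.

Set Implicit Arguments.
Unset Strict Implicit.
Unset Printing Implicit Defensive.

Import Order.TTheory GRing.Theory Num.Theory.
Import numFieldNormedType.Exports.

Local Open Scope classical_set_scope.
Local Open Scope ring_scope.

Section Trees.
Variables (V : finType) (e : rel V).

(* A simple graph is a symmetric irreflexive relation.  A duplicate-free closed
   walk of length 2 merely traverses one edge twice, hence the bound. *)
Definition is_tree : Prop :=
  [/\ symmetric e, irreflexive e, forall u v, connect e u v
    & forall c : seq V, ucycle e c -> (size c <= 2)%N].

(* [v] is [j] or an ancestor of [j] in the tree rooted at [r]. *)
Definition on_path (r v j : V) : Prop :=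
  exists p : seq V,
    [/\ path e r p, last r p = j, uniq (r :: p) & v \in r :: p].

Definition ch (r v : V) : {set V} := [set j | e v j && `[< on_path r v j >]]%SET.

(* The root has no parent; the value [pa r r] is irrelevant. *)
Definition pa (r v : V) : V := odflt r [pick u | v \in ch r u].

Section Eta.
Variables (R : pzRingType) (r : V) (t theta : V -> R).

Fixpoint eta_iter (n : nat) (v : V) : R :=
  if n is n'.+1 then
    t v * \prod_(j in ch r v) (1 - theta j + theta j * eta_iter n' j)
  else 0.

(* Every descending chain has at most #|V| vertices, so the cut-off in
   [eta_iter] is never reached; see [tree_eta_rec]. *)
Definition tree_eta (v : V) : R := eta_iter #|V| v.

End Eta.

Lemma tree_path_uniq x p q :
  is_tree -> path e x p -> path e x q -> last x p = last x q ->
  uniq (x :: p) -> uniq (x :: q) -> p = q.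
Proof.
move=> [e_sym e_irr _ e_acyc].
elim: p x q => [|a p IH] x [|b q] //=.
- by move=> _ _ lq _ /andP[]; rewrite lq mem_last.
- by move=> _ _ lq /andP[]; rewrite -lq mem_last.
move=> /andP[xa pap] /andP[xb pbq] lpq /andP[xp up] /andP[xq uq].
have [ab|nab] := eqVneq a b.
  by rewrite -ab in pbq lpq uq *; rewrite (IH _ _ pap pbq lpq up uq).
pose f := [rel u w | [&& e u w, u != x & w != x]].
have f_sym : symmetric f.
  by move=> u w /=; rewrite e_sym; congr (_ && _); rewrite andbC.
have fpath : forall c s, path e c s -> x \notin c :: s -> path f c s.
  move=> c s; elim: s c => //= y s IHs c /andP[cy ys].
  rewrite !inE !negb_or => /and3P[xc xy xs].
  by rewrite cy eq_sym xc eq_sym xy IHs // inE negb_or xy.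
have fa : connect f a (last a p) by apply/connectP; exists p => //; exact: fpath.
have fb : connect f b (last a p).
  by rewrite lpq; apply/connectP; exists q => //; exact: fpath.
have : connect f a b.
  by apply: connect_trans fa _; rewrite (sym_connect_sym f_sym).
case/connectP => s0 fs0 bl; move: bl; case/shortenP: fs0 => s fs us _ bl.
have es : path e a s by apply: sub_path fs => u w /and3P[].
have xs : x \notin a :: s.
  have ax : a != x by apply: contraNneq xp => <-; rewrite inE eqxx.
  rewrite inE negb_or eq_sym ax /=.
  elim: s a fs {bl us es ax xa xp pap nab lpq fa up fb} => //= y s IHs c.
  move=> /andP[/and3P[_ _ yx] ys].
  by rewrite inE negb_or eq_sym yx (IHs y).
have : ucycle e (x :: a :: s).
  by rewrite /ucycle /= xs xa rcons_path es -bl e_sym xb.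
move/e_acyc => /=; case: s bl {fs us es xs} => //= bl _.
by rewrite bl eqxx in nab.
Qed.

Lemma on_path_split r u v q :
  is_tree -> on_path r u v -> path e r q -> uniq (r :: q) -> v \in r :: q ->
  exists p q2, [/\ q = p ++ q2, last r p = v & u \in r :: p].
Proof.
move=> treeE [p [pp pl up pu]] qp uq qv.
case/splitPl: q / qv qp uq => q1 q2 lq1.
rewrite cat_path -cat_cons cat_uniq => /andP[q1p _] /and3P[uq1 _ _].
have -> : q1 = p by apply: (tree_path_uniq treeE q1p pp); rewrite ?lq1 ?pl.
by exists p, q2.
Qed.

Lemma on_path_trans r u v w :
  is_tree -> on_path r u v -> on_path r v w -> on_path r u w.
Proof.
move=> treeE uv [q [qp ql uq qv]].
have [p [q2 [dq _ pu]]] := on_path_split treeE uv qp uq qv.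
by exists q; split=> //; rewrite dq -cat_cons mem_cat pu.
Qed.

Lemma on_path_anti r u v : is_tree -> on_path r u v -> on_path r v u -> u = v.
Proof.
move=> treeE uv vu; have [q [qp ql uq qv]] := vu.
have [p [q2 [dq pl pu]]] := on_path_split treeE uv qp uq qv.
have [pp up] : path e r p /\ uniq (r :: p).
  move: qp uq; rewrite dq cat_path -cat_cons cat_uniq.
  by move=> /andP[-> _] /and3P[-> _ _].
have [q' [p2 [dp ql' _]]] := on_path_split treeE vu pp up pu.
have [q'p uq'] : path e r q' /\ uniq (r :: q').
  move: pp up; rewrite dp cat_path -cat_cons cat_uniq.
  by move=> /andP[-> _] /and3P[-> _ _].
have q'q : q' = q by apply: (tree_path_uniq treeE q'p qp); rewrite ?ql' ?ql.
have q20 : size q2 = 0%N.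
  have := congr1 size dq; have := congr1 size dp; rewrite !size_cat q'q; lia.
by rewrite -ql -pl dq (size0nil q20) cats0.
Qed.

Lemma on_path_refl r v : is_tree -> on_path r v v.
Proof.
move=> [_ _ e_conn _]; case/connectP: (e_conn r v) => p0 + vl.
move=> p0p; move: vl; case/shortenP: p0p => p pp up _ vl.
by exists p; split=> //; rewrite vl mem_last.
Qed.

Lemma tree_eta_rec (R : pzRingType) (r : V) (t theta : V -> R) (v : V) :
  is_tree ->
  tree_eta r t theta v =
    t v * \prod_(j in ch r v) (1 - theta j + theta j * tree_eta r t theta j).
Proof.
move=> treeE; pose sub x : {set V} := [set j | `[< on_path r x j >]]%SET.
have sub_gt0 x : (0 < #|sub x|)%N.
  by apply/card_gt0P; exists x; rewrite inE; apply/asboolP/on_path_refl.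
have sub_ch x j : j \in ch r x -> (#|sub j| < #|sub x|)%N.
  rewrite inE => /andP[exj /asboolW xj].
  apply/proper_card/properP; split.
    apply/fintype.subsetP => k; rewrite !inE => jk.
    exact: (on_path_trans treeE xj jk).
  exists x; first by rewrite inE; apply/asboolP/on_path_refl.
  rewrite inE; apply/negP => /asboolW jx; have [_ e_irr _ _] := treeE.
  by move: exj; rewrite (on_path_anti treeE xj jx) e_irr.
have stable n m x : (#|sub x| <= n)%N -> (#|sub x| <= m)%N ->
    eta_iter r t theta n x = eta_iter r t theta m x.
  elim: n m x => [|n IH] [|m] x; try by rewrite leqNgt sub_gt0.
    by move=> _; rewrite leqNgt sub_gt0.
  move=> xn xm /=; congr (_ * _); apply: eq_bigr => j /sub_ch jx.
  by rewrite (IH m) // -ltnS (leq_trans jx).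
rewrite /tree_eta (stable _ #|V|.+1) //; first exact: max_card.
exact/leqW/max_card.
Qed.

End Trees.

Section Model.
Variables (R : realType) (V : finType) (e : rel V).
Variables (lambda : V -> R) (alpha : V -> V -> R).

Definition admissible : Prop :=
  [/\ forall v, 0 < lambda v, forall u v, e u v -> alpha u v = alpha v u
    & forall u v, e u v ->
        0 < alpha u v <= Num.min (Num.sqrt (lambda u / lambda v))
                                 (Num.sqrt (lambda v / lambda u))].

Definition thinning_par (r v : V) : R :=
  alpha (pa e r v) v * Num.sqrt (lambda v / lambda (pa e r v)).

Definition innovation_par (r v : V) : R :=
  lambda v * (1 - alpha (pa e r v) v * Num.sqrt (lambda (pa e r v) / lambda v)).

End Model.

(* Mutual independence, over the index set [D], of the families of events
   [F i]. *)
Definition indep_events (d : measure_display) (T : measurableType d)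
    (R : realType) (P : probability T R) (I : choiceType) (D : set I)
    (F : I -> set (set T)) : Prop :=
  forall (J : {fset I}) (A : I -> set T), [set` J] `<=` D ->
    (forall i, i \in J -> F i (A i)) ->
    P (\bigcap_(i in [set` J]) A i) = (\prod_(i <- J) P (A i))%E.

Definition sigma_rvs (d d' : measure_display) (T : measurableType d)
    (E : measurableType d') (I : Type) (D : set I) (X : I -> T -> E) :
    set (set T) :=
  <<s \bigcup_(i in D) preimage_set_system setT (X i) measurable >>.

Definition indep_rvs (d d' : measure_display) (T : measurableType d)
    (E : measurableType d') (R : realType) (P : probability T R)
    (I : choiceType) (D : set I) (X : I -> T -> E) : Prop :=
  indep_events P D (fun i => preimage_set_system setT (X i) measurable).

Definition thinning (T : Type) (Ber : nat -> T -> bool) (Y : T -> nat) (w : T)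
    : nat := (\sum_(j < Y w) Ber j w)%N.

Section MPMRF.
Variables (R : realType) (V : finType) (e : rel V).
Variables (lambda : V -> R) (alpha : V -> V -> R).

(* [Ber v] is the sequence thinning [N (pa v)]; [Ber r] plays no role.  The
   second argument of [poisson_prob] is unused, and [poisson_prob 0 _] is the
   point mass at 0. *)
Definition MPMRF_construction (d : measure_display) (T : measurableType d)
    (P : probability T R) (r : V) (N : V -> T -> nat)
    (L : V -> {RV P >-> nat}) (Ber : V -> nat -> {RV P >-> bool}) : Prop :=
  let nonroot := [set v | v != r] in
  [/\ [/\ distribution P (L r) =1 poisson_prob (lambda r) 0%N,
          forall v, v != r -> distribution P (L v)
            =1 poisson_prob (innovation_par e lambda alpha r v) 0%N
        & forall v j, v != r -> distribution P (Ber v j)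
            =1 bernoulli_prob (thinning_par e lambda alpha r v)],
      [/\ indep_rvs P setT (fun v => L v : T -> nat),
          forall v, v != r -> indep_rvs P setT (fun j => Ber v j : T -> bool)
        & indep_events P [set o | if o is Some v then nonroot v else True]
            (fun o : option V =>
               if o is Some v
               then sigma_rvs setT (fun j => Ber v j : T -> bool)
               else sigma_rvs setT (fun v => L v : T -> nat))],
      N r =1 L r
    & forall v, v != r -> forall w,
        N v w = (thinning (Ber v) (N (pa e r v)) w + L v w)%N].

(* [N ~ MPMRF(lambda, alpha, T)] prescribes only the law of [N], which is that
   of a vector obtained by the construction on some probability space. *)
Definition MPMRF (d : measure_display) (T : measurableType d)
    (P : probability T R) (N : V -> T -> nat) : Prop :=
  exists (d' : measure_display) (T' : measurableType d')
         (P' : probability T' R) (r : V) (N' : V -> T' -> nat)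
         (L : V -> {RV P' >-> nat}) (Ber : V -> nat -> {RV P' >-> bool}),
    MPMRF_construction r N' L Ber /\
    forall A : set (V -> nat),
      P [set w | A (fun v => N v w)] = P' [set w | A (fun v => N' v w)].

End MPMRF.

Section GeneratingFunctions.
Variables (d : measure_display) (T : measurableType d) (R : realType).
Variable (P : probability T R).

Definition mean (Z : T -> nat) : \bar R := ('E_P[fun w => (Z w)%:R])%E.

Definition pgf (Z : T -> nat) (t : R) : R := fine ('E_P[fun w => (t ^+ Z w)%R])%E.

(* [t * d/dt pgf Z t] as a power series, so that it makes sense at [t = 1] and
   [t = -1] too; the term of index 0 vanishes. *)
Definition pgf_tderiv (Z : T -> nat) (t : R) : R :=
  limn (series (fun k => k%:R * fine (P [set w | Z w = k]) * t ^+ k)).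

Definition expected_alloc (X S : T -> nat) (k : nat) : \bar R :=
  ('E_P[fun w => ((X w)%:R * \1_[set w' | S w' = k] w)%R])%E.

End GeneratingFunctions.

(* Main.v *)
(** The generating function of [N] is [exp Phi] with
    [Phi x = \sum_v c_v * (eta_v x - 1)], where [c_v] is the rate of the
    innovation at [v]: leaves are peeled off one at a time, and removing a leaf
    [u] multiplies the variable of its parent by [1 - theta_u + theta_u * x_u].
    Moving the root to a neighbour leaves [Phi] unchanged, because the two
    thinning parameters of an edge [(r, r')] satisfy
    [lambda_r * theta_r' = lambda_r' * theta_r]; hence the tree may be rooted
    at the vertex [v] of the statement, whatever the root of the construction.
    Then [Phi] is affine in [x_v], and comparing the coefficients of [x_v ^ k]
    shows that, weighted by the other variables, [N_v = k] has the Poisson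
    shape [C * (lambda_v * rho) ^ k / k!], with [x_v * rho = eta_v x].
    Conditioning on [N], [X_v * t ^ S] becomes
    [E (B_v t ^ B_v) * N_v * p_v ^ (N_v - 1) * \prod_(u != v) p_u ^ N_u]
    where [p_u = E (t ^ B_u)], and summing over the values of [N_v] gives the
    theorem. *)

Require Import Defs.
From HB Require Import structures.
From mathcomp Require Import all_boot all_order all_algebra.
From mathcomp Require Import finmap ring lra zify.
From mathcomp Require Import all_classical all_reals all_analysis.
From mathcomp Require Import measurable_realfun.

Set Implicit Arguments.
Unset Strict Implicit.
Unset Printing Implicit Defensive.

Import Order.TTheory GRing.Theory Num.Theory.
Import numFieldNormedType.Exports.

Local Open Scope classical_set_scope.
Local Open Scope ring_scope.

(** * Discrete random variables and integrals over their fibers *)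

(** The coefficients of [x_v ^ k] are compared, rather than the generating function differentiated
    in [x_v], because at [t = 1] and [t = -1] the point [p_v] may lie on the boundary of the region
    [|x_v| <= 1] where that function is known; a series indexed by the values of [N_v] makes sense
    there, and at [p_v = 0] as well. All variables being integer-valued, conditioning is done
    without conditional expectations or product spaces: an integral is the sum of its restrictions
    to the countably many events on which a discrete variable is constant, and on such an event
    random numbers of terms become fixed, so that independence applies. For negative [t] the
    integrands change sign, so integrability must be secured before fibers are summed; it comes from
    the same fiber identity for the absolute values, that is, with [|t|] in place of [t]. *)

Section Discrete.
Context d (T : measurableType d).

(* For a countable codomain this is measurability for its discrete
   sigma-algebra; no such structure is needed on [C]. *)
Definition dmeasurable (C : Type) (U : T -> C) : Prop :=
  forall c, measurable [set w | U w = c].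

Lemma dmeasurable_preimage (C : countType) (U : T -> C) (A : set C) :
  dmeasurable U -> measurable (U @^-1` A).
Proof.
move=> mU; have -> : U @^-1` A = \bigcup_(c : C) ([set w | U w = c] `&` [set _ | A c]).
  by apply/seteqP; split=> [w Aw|w [c _] [/= ->]]; [exists (U w)|].
apply: countable_bigcupT_measurable => [|c]; first exact: countableP.
have [Ac|nAc] := pselect (A c).
- by rewrite (_ : [set _ | A c] = setT) ?setIT //; apply/seteqP; split.
- by rewrite (_ : [set _ | A c] = set0) ?setI0 //; apply/seteqP; split.
Qed.

Lemma dmeasurable_nat (U : T -> nat) : dmeasurable U <-> measurable_fun setT U.
Proof.
split=> mU; first by move=> _ A _; rewrite setTI; exact: dmeasurable_preimage.
by move=> c; rewrite -[X in measurable X]setTI; apply: (mU measurableT [set c]).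
Qed.

Lemma dmeasurable_comp (C : countType) (C' : Type) (U : T -> C) (f : C -> C') :
  dmeasurable U -> dmeasurable (f \o U).
Proof. by move=> mU c; exact: (dmeasurable_preimage [set a | f a = c]). Qed.

Lemma measurable_glue d' (E : measurableType d') (C : countType) (U : T -> C)
    (f : C -> T -> E) :
  dmeasurable U -> (forall c, measurable_fun setT (f c)) ->
  measurable_fun setT (fun w => f (U w) w).
Proof.
move=> mU mf _ A mA; rewrite setTI.
have -> : (fun w => f (U w) w) @^-1` A =
    \bigcup_(c : C) ([set w | U w = c] `&` f c @^-1` A).
  by apply/seteqP; split=> [w Aw|w [c _] [/= <-]]; [exists (U w)|].
apply: countable_bigcupT_measurable => [|c]; first exact: countableP.
by apply: measurableI => //; rewrite -[X in measurable X]setTI; exact: mf.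
Qed.

Lemma measurable_dcomp d' (E : measurableType d') (C : countType) (U : T -> C)
    (g : C -> E) : dmeasurable U -> measurable_fun setT (fun w => g (U w)).
Proof. by move=> mU; apply: (measurable_glue (f := fun c _ => g c) mU). Qed.

(** The index [U w] is random, as in a thinning or a compound sum, whose number of terms depends on
    [w]. *)
Lemma dmeasurable_glue (C C' : countType) (U : T -> C) (f : C -> T -> C') :
  dmeasurable U -> (forall c, dmeasurable (f c)) ->
  dmeasurable (fun w => f (U w) w).
Proof.
move=> mU mf a.
rewrite (_ : mkset _ =
    \bigcup_(c : C) ([set w | U w = c] `&` [set w | f c w = a])); last first.
  by apply/seteqP; split=> [w Aw|w [c _] [/= <-]]; [exists (U w)|].
apply: countable_bigcupT_measurable => [|c]; first exact: countableP.
by apply: measurableI; [exact: mU|exact: mf].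
Qed.

Lemma dmeasurable_finfun (I : finType) (C : choiceType) (f : I -> T -> C) :
  (forall i, dmeasurable (f i)) -> dmeasurable (fun w => [ffun i => f i w]).
Proof.
move=> mf c; rewrite (_ : mkset _ = \bigcap_(i in [set: I]) [set w | f i w = c i]).
  by apply: fin_bigcap_measurable => // i _; exact: mf.
apply/seteqP; split=> [w /= <- i _ /=|w /= fc]; first by rewrite ffunE.
by apply/ffunP => i; rewrite ffunE; exact: fc.
Qed.

Lemma measurable_Xn (R : realType) (x : R) (U : T -> nat) : dmeasurable U ->
  measurable_fun setT (fun w => x ^+ U w).
Proof. exact: (measurable_dcomp (fun k => x ^+ k)). Qed.

End Discrete.

Section Partition.
Context d (T : measurableType d) (R : realType) (P : probability T R).
Implicit Types (D : set T) (f g : T -> R).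
Local Notation integrable D f := (P.-integrable D (EFin \o f)).

Lemma bounded_integrable D f (M : R) : measurable D -> measurable_fun setT f ->
  (forall w, `|f w| <= M) -> integrable D f.
Proof.
move=> mD mf fM; apply: measurable_bounded_integrable => //.
- exact: le_lt_trans (probability_le1 P mD) (ltry _).
- exact: measurable_funTS.
- exists M; split; first exact: num_real.
  by move=> x Mx w _; exact: le_trans (fM w) (ltW Mx).
Qed.

Lemma integrable_Xn (y : R) (U : T -> nat) : `|y| <= 1 -> dmeasurable U ->
  integrable setT (fun w => y ^+ U w).
Proof.
move=> y1 mU; apply: (@bounded_integrable _ _ 1) => //.
  exact: measurable_Xn.
by move=> w; rewrite normrX exprn_ile1.
Qed.

Lemma norm_prod_Xn_le1 (I : finType) (Q : pred I) (x : I -> R) (n : I -> nat) :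
  (forall i, `|x i| <= 1) -> `|\prod_(i | Q i) x i ^+ n i| <= 1.
Proof.
move=> x1; rewrite normr_prod; apply: prodr_ile1 => i _.
by rewrite normr_ge0 normrX exprn_ile1.
Qed.

Lemma measurable_prod_Xn (I : finType) (Q : pred I) (x : I -> R)
    (U : I -> T -> nat) : (forall i, dmeasurable (U i)) ->
  measurable_fun setT (fun w => \prod_(i | Q i) x i ^+ U i w).
Proof.
move=> mU; rewrite (_ : (fun w => _) =
    fun w => \prod_i (if Q i then x i ^+ U i w else 1)).
  by apply: measurable_prod => i _; case: (Q i) => //; exact: measurable_Xn.
by apply/funext => w; rewrite big_mkcond.
Qed.

Lemma integrable_prod_Xn D (I : finType) (Q : pred I) (x : I -> R)
    (U : I -> T -> nat) : measurable D -> (forall i, `|x i| <= 1) ->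
  (forall i, dmeasurable (U i)) ->
  integrable D (fun w => \prod_(i | Q i) x i ^+ U i w).
Proof.
move=> mD x1 mU; apply: (@bounded_integrable _ _ 1) => //.
  exact: measurable_prod_Xn.
by move=> w; exact: norm_prod_Xn_le1.
Qed.

Lemma EFin_Rintegral D f : measurable D -> integrable D f ->
  (\int[P]_(w in D) f w)%:E = (\int[P]_(w in D) (f w)%:E)%E.
Proof. by move=> mD fi; rewrite /Rintegral fineK //; exact: integrable_fin_num. Qed.

Lemma bigcup_fibers (C : Type) (U : T -> C) :
  \bigcup_c [set w | U w = c] = [set: T].
Proof. by apply/seteqP; split=> // w _; exists (U w). Qed.

Lemma trivIset_fibers (C : Type) (U : T -> C) :
  trivIset setT (fun c => [set w | U w = c]).
Proof. by move=> a b _ _ [w [/= <- <-]]. Qed.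

Lemma series_Rintegral_ge0 (U : T -> nat) f :
  dmeasurable U -> integrable setT f -> (forall w, 0 <= f w) ->
  series (fun k => \int[P]_(w in [set w | U w = k]) f w) @ \oo
    --> \int[P]_w f w.
Proof.
move=> mU fi f0.
have mF k : measurable [set w | U w = k] by exact: mU.
have fi_ k : integrable ([set w | U w = k]) f.
  by apply: integrableS fi.
rewrite (_ : series _ = fine \o eseries
    (fun k => \int[P]_(w in [set w | U w = k]) (f w)%:E)%E); last first.
  apply/funext => n /=; rewrite /series /eseries /= -[LHS]/(fine _%:E) -sumEFin.
  by congr fine; apply: eq_bigr => k _; rewrite EFin_Rintegral.
apply: fine_cvg; rewrite EFin_Rintegral // -[X in (\int[P]_(_ in X) _)%E](bigcup_fibers U).
rewrite ge0_integral_bigcup //.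
- by apply: is_cvg_nneseries => n _ _; apply: integral_ge0 => w _; rewrite lee_fin.
- by rewrite bigcup_fibers; exact: measurable_int fi.
- by move=> w _; rewrite lee_fin.
- exact: trivIset_fibers.
Qed.

(** A signed [f] is the difference of the nonnegative functions [f + |f|] and [|f|], to which
    countable additivity applies. *)
Lemma series_Rintegral (U : T -> nat) f :
  dmeasurable U -> integrable setT f ->
  series (fun k => \int[P]_(w in [set w | U w = k]) f w) @ \oo
    --> \int[P]_w f w.
Proof.
move=> mU fi.
have nfi : integrable setT (fun w => `|f w|) by exact: integrable_norm.
have si : integrable setT (fun w => f w + `|f w|).
  exact: (integrableD measurableT fi nfi).
have mF k : measurable [set w | U w = k] by exact: mU.
have iS g k : integrable setT g -> integrable ([set w | U w = k]) g.
  by move=> gi; apply: integrableS gi.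
have -> : \int[P]_w f w =
    \int[P]_w (f w + `|f w|) - \int[P]_w `|f w|.
  by rewrite RintegralD // addrK.
rewrite (_ : series _ =
  series (fun k => \int[P]_(w in [set w | U w = k]) (f w + `|f w|))
  \- series (fun k => \int[P]_(w in [set w | U w = k]) `|f w|)).
  apply: cvgB; apply: series_Rintegral_ge0 => // w.
  by have := ler_norm (- f w); rewrite normrN -subr_ge0 opprK addrC.
apply/funext => n; rewrite /series /= -sumrB; apply: eq_bigr => k _.
by rewrite RintegralD ?addrK //; exact: iS.
Qed.

(** Conditioning on [U]: integrability on each fiber does not bound the total, so a globally
    integrable [g'] with the fiber integrals of [|f|] is required as well. It makes the sum of the
    integrals of [|f|] finite, and the fibers may then be summed for [f] itself. *)
Lemma cond_Rintegral (C : countType) (U : T -> C) f g g' :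
  dmeasurable U -> measurable_fun setT f ->
  integrable setT g -> integrable setT g' ->
  (forall c, integrable ([set w | U w = c]) f) ->
  (forall c, \int[P]_(w in [set w | U w = c]) f w =
             \int[P]_(w in [set w | U w = c]) g w) ->
  (forall c, \int[P]_(w in [set w | U w = c]) `|f w| =
             \int[P]_(w in [set w | U w = c]) g' w) ->
  integrable setT f /\ \int[P]_w f w = \int[P]_w g w.
Proof.
move=> mU mf gi g'i fi_ fg fg'.
(* Values are encoded as natural numbers, so that the fibers are summed as a series; numbers that
   encode no value taken by [U] give empty fibers. *)
have mV : dmeasurable (choice.pickle \o U) by exact: dmeasurable_comp.
pose F k := [set w | choice.pickle (U w) = k].
have mF k : measurable (F k) by exact: mV.
have FE k : (exists c, F k = [set w | U w = c]) \/ F k = set0.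
  have [[w <-]|F0] := pselect (exists w, F k w).
    left; exists (U w); apply/seteqP; split=> v /= UE.
      exact: (pcan_inj choice.pickleK UE).
    by rewrite /F /= UE.
  by right; apply/seteqP; split=> // w Fw; apply: F0; exists w.
have fi k : integrable (F k) f.
  by have [[c ->]|->] := FE k; [exact: fi_|exact: integrable_set0].
have nfE k : \int[P]_(w in F k) `|f w| = \int[P]_(w in F k) g' w.
  by have [[c ->]|->] := FE k; rewrite ?Rintegral_set0.
have fE k : \int[P]_(w in F k) f w = \int[P]_(w in F k) g w.
  by have [[c ->]|->] := FE k; rewrite ?Rintegral_set0.
have fi' : integrable setT f.
  apply/integrableP; split; first exact/measurable_EFinP.
  rewrite -[X in (\int[P]_(_ in X) _)%E](bigcup_fibers (choice.pickle \o U)).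
  rewrite ge0_integral_bigcup //; last 2 first.
  - rewrite bigcup_fibers; apply/measurable_EFinP.
    exact: measurableT_comp.
  - exact: trivIset_fibers.
  rewrite (eq_eseriesr (g := fun k => \int[P]_(w in F k) (g' w)%:E)%E); last first.
    move=> k _; transitivity (\int[P]_(w in F k) `|f w|)%:E.
      by rewrite EFin_Rintegral //; exact: (integrable_norm (fi k)).
    by rewrite nfE EFin_Rintegral //; exact: integrableS g'i.
  rewrite -integral_bigcup //; last by rewrite bigcup_fibers.
    by rewrite bigcup_fibers; exact/(integrable_lty measurableT).
  exact: trivIset_fibers.
split=> //; apply: (cvg_unique _ (series_Rintegral mV fi')) => //=.
rewrite (_ : (fun k => _) = fun k => \int[P]_(w in F k) g w); last exact/funext.
exact: series_Rintegral.
Qed.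

End Partition.

(** * Expectations of products under independence *)

Section Expectation.
Context d (T : measurableType d) (R : realType) (P : probability T R).
Local Notation integrable D f := (P.-integrable D (EFin \o f)).

Lemma Rintegral_const_on D (f : T -> R) a : measurable D ->
  (forall w, D w -> f w = a) -> \int[P]_(w in D) f w = a * fine (P D).
Proof.
move=> mD fa; rewrite -(Rintegral_cst P mD); apply: eq_Rintegral => w /[!inE].
exact: fa.
Qed.

Lemma integrable_restrict D E (f : T -> R) : measurable D -> measurable E ->
  integrable (D `&` E) f -> integrable D (f \_ E).
Proof.
move=> mD mE /(integrable_mkcond _ (measurableI _ _ mD mE)) fi.
apply/(integrable_mkcond _ mD); rewrite -restrict_EFin.
by rewrite -patch_setI setIC in fi *.
Qed.

Lemma integrable_const_on D (f : T -> R) a : measurable D ->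
  (forall w, D w -> f w = a) -> integrable D f.
Proof.
move=> mD fa; apply: (eq_integrable mD (cst a%:E)) => [w /[!inE] /fa <- //|].
apply: (integrableS measurableT mD (@subsetT _ _)).
exact: finite_measure_integrable_cst.
Qed.

Lemma series_Rintegral_comp (U : T -> nat) (g : nat -> R) :
  dmeasurable U -> integrable setT (fun w => g (U w)) ->
  series (fun k => g k * fine (P [set w | U w = k])) @ \oo
    --> \int[P]_w g (U w).
Proof.
move=> mU gi; rewrite (_ : (fun k => _) =
    (fun k => \int[P]_(w in [set w | U w = k]) g (U w))).
  exact: series_Rintegral.
apply/funext => k; rewrite (Rintegral_const_on (a := g k)) //.
by move=> w /= ->.
Qed.

(* By induction on [s1]: summing over the values of [Y i] moves the index [i]
   from [s1] to [s2], with the event [Y i = k]. *)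
Lemma indep_prod_setI (I : choiceType) (D : set I) (F : I -> set (set T))
    (Y : I -> T -> nat) (g : I -> nat -> R) (s1 s2 : seq I) (A : I -> set T) :
  indep_events P D F -> uniq (s1 ++ s2) -> {in s1 ++ s2, forall i, D i} ->
  {in s1, forall i k, F i [set w | Y i w = k]} ->
  {in s1, forall i, dmeasurable (Y i)} ->
  {in s1, forall i, integrable setT (fun w => g i (Y i w))} ->
  {in s2, forall i, F i (A i)} -> {in s2, forall i, measurable (A i)} ->
  let E := \bigcap_(i in [set` s2]) A i in
  integrable E (fun w => \prod_(i <- s1) g i (Y i w)) /\
  \int[P]_(w in E) \prod_(i <- s1) g i (Y i w) =
    \prod_(i <- s1) \int[P]_w g i (Y i w) * \prod_(i <- s2) fine (P (A i)).
Proof.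
move=> indep.
have mcap (s : seq I) (B : I -> set T) : {in s, forall i, measurable (B i)} ->
    measurable (\bigcap_(i in [set` s]) B i).
  by move=> mB; apply: fin_bigcap_measurable => // i; exact: mB.
elim: s1 s2 A g => [|i s1 IH] s2 A g us Ds FY mY gi FA mA E.
  have mE : measurable E by exact: mcap.
  have h w : E w -> \prod_(j <- [::]) g j (Y j w) = 1 by rewrite big_nil.
  split; first exact: integrable_const_on mE h.
  rewrite (Rintegral_const_on mE h) // big_nil; congr (_ * _).
  pose J := [fset j in s2]%fset.
  have JE : [set` J] = [set` s2] by apply/seteqP; split=> j /=; rewrite inE.
  rewrite /E -JE indep; first 1 last.
  - by move=> j /=; rewrite inE => /Ds.
  - by move=> j; rewrite inE => /FA.
  have pE : perm_eq J s2 by apply: uniq_perm => //= j; rewrite inE.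
  rewrite (perm_big _ pE) /=.
  rewrite (eq_big_seq (fun j => (fine (P (A j)))%:E)) ?prodEFin // => j js.
  by rewrite fineK //; exact/fin_num_measure/mA.
have is0 : i \notin s1 ++ s2 by have /andP[] := us.
have us' : uniq (s1 ++ i :: s2).
  by rewrite (perm_uniq (permEl (perm_catCA s1 [:: i] s2))).
pose A' a j := if j == i then [set w | Y i w = a] else A j.
have A's a : {in s2, A' a =1 A}.
  move=> j js; rewrite /A'; case: eqP => // ji.
  by move: is0; rewrite -ji mem_cat js orbT.
have E'E a : \bigcap_(j in [set` i :: s2]) A' a j = [set w | Y i w = a] `&` E.
  apply/seteqP; split=> w.
    move=> h; split; first by have := h i; rewrite /A' eqxx; apply; exact: mem_head.
    by move=> j /= js; rewrite -(A's a j js); apply: h; rewrite /= inE js orbT.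
  by move=> [Yw Ew] j /=; rewrite inE /A'; case: eqP => //= ji js; exact: Ew.
have in1 : {subset s1 <= i :: s1} by move=> j js; rewrite inE js orbT.
have Ds' : {in s1 ++ i :: s2, forall j, D j}.
  by move=> j; rewrite mem_cat inE orbCA -mem_cat; exact: Ds.
have FA' a : {in i :: s2, forall j, F j (A' a j)}.
  move=> j; rewrite inE /A'; case: eqP => [->|_] /= js; last exact: FA.
  by apply: FY; rewrite mem_head.
have mA' a : {in i :: s2, forall j, measurable (A' a j)}.
  move=> j; rewrite inE /A'; case: eqP => [->|_] /= js; last exact: mA.
  by apply: mY; rewrite mem_head.
have mE : measurable E by exact: mcap.
have mYi : dmeasurable (Y i) by apply: mY; rewrite mem_head.
pose K := \prod_(j <- s2) fine (P (A j)).
(* Stated for an arbitrary [h], since conditioning on [Y i] uses it twice: for [g], and for [|g|] to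
   obtain integrability. *)
have step (h : I -> nat -> R) :
    {in s1, forall j, integrable setT (fun w => h j (Y j w))} ->
    forall a, integrable ([set w | Y i w = a] `&` E)
      (fun w => \prod_(j <- i :: s1) h j (Y j w)) /\
    \int[P]_(w in [set w | Y i w = a] `&` E) \prod_(j <- i :: s1) h j (Y j w) =
    \int[P]_(w in [set w | Y i w = a])
      (h i (Y i w) * (\prod_(j <- s1) \int[P]_w h j (Y j w) * K)).
  move=> hi a; have mYE : measurable ([set w | Y i w = a] `&` E).
    by apply: measurableI => //; exact: mYi.
  have FY1 : {in s1, forall j k, F j [set w | Y j w = k]} by move=> j /in1; exact: FY.
  have mY1 : {in s1, forall j, dmeasurable (Y j)} by move=> j /in1; exact: mY.
  have [int1 eq1] := IH (i :: s2) (A' a) h us' Ds' FY1 mY1 hi (FA' a) (mA' a).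
  rewrite E'E in int1 eq1.
  have hE w : ([set w | Y i w = a] `&` E) w ->
      \prod_(j <- i :: s1) h j (Y j w) = h i a * \prod_(j <- s1) h j (Y j w).
    by move=> [/= Yw _]; rewrite big_cons Yw.
  split.
    apply: (eq_integrable mYE (EFin \o (fun w => h i a * \prod_(j <- s1) h j (Y j w)))).
      by move=> w /[!inE] Yw /=; rewrite hE.
    rewrite (_ : EFin \o _ = fun w => ((h i a)%:E * (\prod_(j <- s1) h j (Y j w))%:E)%E) //.
    exact: integrableZl.
  transitivity (\int[P]_(w in [set w | Y i w = a] `&` E)
                  (h i a * \prod_(j <- s1) h j (Y j w))).
    by apply: eq_Rintegral => w /[!inE] /hE.
  rewrite RintegralZl // eq1 big_cons /A' eqxx.
  rewrite (@Rintegral_const_on _ _ (h i a * (\prod_(j <- s1) \int[P]_w h j (Y j w) * K))).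
  - rewrite -!mulrA; congr (_ * (_ * _)); rewrite mulrC; congr (_ * _).
    by apply: eq_big_seq => j js; rewrite -[in RHS](A's a j js).
  - exact: mYi.
  - by move=> w /= ->.
have gi1 : {in s1, forall j, integrable setT (fun w => g j (Y j w))}.
  by move=> j /in1; exact: gi.
have gii : integrable setT (fun w => g i (Y i w)) by apply: gi; rewrite mem_head.
have ngi1 : {in s1, forall j, integrable setT (fun w => `|g j (Y j w)|)}.
  by move=> j js; apply: integrable_norm (gi1 j js).
have mprod : measurable_fun setT (fun w => \prod_(j <- i :: s1) g j (Y j w)).
  by apply: measurable_prod => j js; apply: measurable_dcomp; exact: mY.
have Zr (h : T -> R) c : integrable setT h -> integrable setT (fun w => h w * c).
  move=> hi; rewrite (_ : EFin \o _ = fun w => ((h w)%:E * c%:E)%E) //.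
  exact: integrableZr.
have [] := @cond_Rintegral _ _ _ P _ (Y i)
  ((fun w => \prod_(j <- i :: s1) g j (Y j w)) \_ E)
  (fun w => g i (Y i w) * (\prod_(j <- s1) \int[P]_w g j (Y j w) * K))
  (fun w => `|g i (Y i w)| * (\prod_(j <- s1) \int[P]_w `|g j (Y j w)| * K)) mYi.
- exact/(measurable_restrictT _ mE)/measurable_funTS.
- exact: Zr.
- by apply: Zr; exact: integrable_norm gii.
- by move=> a; apply: integrable_restrict => //; exact: (step g gi1 a).1.
- by move=> a; rewrite -Rintegral_mkcondr (step g gi1 a).2.
- move=> a; rewrite -(step (fun j k => `|g j k|) ngi1 a).2 Rintegral_mkcondr.
  apply: eq_Rintegral => w _; rewrite /patch; case: ifP => _; rewrite ?normr0 //.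
  by rewrite normr_prod.
move=> int2 eq2; split.
  apply/(integrable_mkcond _ mE); move: int2; by rewrite -restrict_EFin.
by rewrite Rintegral_mkcond eq2 RintegralZr // big_cons mulrA.
Qed.
End Expectation.

Section Law.
Context d (T : measurableType d) d' (T' : measurableType d') (R : realType).
Context (P : probability T R) (P' : probability T' R).

(** [MPMRF] fixes only a law, possibly realized on another space, and the claims are copies in law;
    integrals are carried over through the image measure. Encoding values by [pickle] puts both
    image measures on [nat], where every function is measurable. *)
Lemma Rintegral_law (C : countType) (U : T -> C) (U' : T' -> C) (F : C -> R) :
  dmeasurable U -> dmeasurable U' ->
  (forall A, P (U @^-1` A) = P' (U' @^-1` A)) ->
  P'.-integrable setT (EFin \o (F \o U')) ->
  P.-integrable setT (EFin \o (F \o U)) /\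
  \int[P]_w F (U w) = \int[P']_w F (U' w).
Proof.
move=> mU mU' PU F'i.
pose V := choice.pickle \o U; pose V' := choice.pickle \o U'.
pose G k := oapp F 0 (choice.unpickle k).
have GV w : G (V w) = F (U w) by rewrite /G /V /= choice.pickleK.
have GV' w : G (V' w) = F (U' w) by rewrite /G /V' /= choice.pickleK.
have mV : measurable_fun setT V by apply/dmeasurable_nat/dmeasurable_comp.
have mV' : measurable_fun setT V' by apply/dmeasurable_nat/dmeasurable_comp.
have law : pushforward P V = pushforward P' V'.
  by apply/funext => A; rewrite /pushforward; exact: (PU (choice.pickle @^-1` A)).
have mG (f : nat -> \bar R) : measurable_fun setT f by move=> _ A mA.
have mFU : measurable_fun setT (fun w => F (U w)) by exact: measurable_dcomp.
have Fi : P.-integrable setT (EFin \o (F \o U)).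
  apply/integrableP; split; first exact/measurable_EFinP.
  have [_] := integrableP _ _ _ F'i.
  have -> : (\int[P']_w `|(EFin \o (F \o U')) w| =
      \int[pushforward P' V']_k `|(G k)%:E|)%E.
    rewrite ge0_integral_pushforward //.
    by apply: eq_integral => w _ /=; rewrite GV'.
  rewrite -law ge0_integral_pushforward //.
  by under eq_integral => w _ do rewrite /= GV.
split=> //; congr fine.
transitivity (\int[pushforward P V]_k (G k)%:E)%E.
  rewrite integral_pushforward // ?preimage_setT.
    by apply: eq_integral => w _ /=; rewrite GV.
  by apply: eq_integrable Fi => // w _ /=; rewrite GV.
rewrite law integral_pushforward // ?preimage_setT.
  by apply: eq_integral => w _ /=; rewrite GV'.
by apply: eq_integrable F'i => // w _ /=; rewrite GV'.
Qed.

End Law.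

(** * Power series with bounded coefficients *)

Section PowerSeries.
Context (R : realType).

(** For [c 0]: when [y <= 1/2] the tail is at most [M * y] times a geometric sum, itself at most 2,
    so [|c 0| <= 2 * M * y], and a small [y] forces [c 0 = 0]. Dividing the series by [y] then
    shifts the coefficients, whence the induction on [k]. *)
Lemma pseries_eq0 (c : nat -> R) (M : R) : (forall k, `|c k| <= M) ->
  (forall y, 0 < y < 1 -> series (fun k => c k * y ^+ k) @ \oo --> (0 : R)) ->
  forall k, c k = 0.
Proof.
have head (c' : nat -> R) : (forall k, `|c' k| <= M) ->
    (forall y, 0 < y < 1 -> series (fun k => c' k * y ^+ k) @ \oo --> (0 : R)) ->
    c' 0 = 0.
  move=> cM c0; have M0 : 0 <= M by apply: le_trans (cM 0).
  have geo (y : R) n : 0 < y <= 2^-1 -> \sum_(0 <= i < n) y ^+ i <= 2.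
    move=> /andP[y0 y1]; have := subrX1 y n; rewrite big_mkord.
    have : 0 <= y ^+ n by rewrite exprn_ge0 // ltW.
    set s := \sum_(i < n) _ => yn E; have : 0 <= s.
      by apply: sumr_ge0 => i _; rewrite exprn_ge0 // ltW.
    nra.
  have bound (y : R) : 0 < y <= 2^-1 -> `|c' 0| <= 2 * M * y.
    move=> yI; have /andP[y0 y1] := yI.
    have yc : 0 < y < 1 by rewrite y0 /=; apply: le_lt_trans y1 _; lra.
    have cv : (fun n => `|series (fun k => c' k * y ^+ k) n - c' 0|) @ \oo --> `|0 - c' 0|.
      by apply: cvg_norm; apply: cvgB; [exact: c0|exact: cvg_cst].
    rewrite sub0r normrN in cv; rewrite -(cvg_lim _ cv) //.
    apply: limr_le; first by apply/cvg_ex; exists `|c' 0|.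
    near=> n; have n0 : (0 < n)%N by near: n; exists 1%N.
    rewrite -(prednK n0) /= /series /= big_nat_recl // expr0 mulr1.
    rewrite -[X in X - _]addrC addrK.
    apply: le_trans (ler_norm_sum _ _ _) _.
    apply: (@le_trans _ _ (\sum_(0 <= i < n.-1) M * y * y ^+ i)).
      apply: ler_sum => i _; rewrite normrM -mulrA -exprS.
      rewrite (ger0_norm (exprn_ge0 _ (ltW y0))).
      by apply: ler_wpM2r => //; rewrite exprn_ge0 // ltW.
    by rewrite -mulr_sumr mulrC -[leRHS]mulrA ler_wpM2r ?geo // mulr_ge0 // ltW.
  have [//|c00] := eqVneq (c' 0) 0; have cpos : 0 < `|c' 0| by rewrite normr_gt0.
  have d0 : 0 < 4 * (M + `|c' 0|) by nra.
  (* This [y] is at most [1/4], and the bound at [y] reads [|c' 0| <= |c' 0| * M / (2 * (M + |c'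
     0|))], whose right side is at most half of [|c' 0|]. *)
  have := bound (`|c' 0| / (4 * (M + `|c' 0|))).
  have -> : 0 < `|c' 0| / (4 * (M + `|c' 0|)) <= 2^-1.
    by rewrite divr_gt0 //= ler_pdivrMr //; nra.
  move=> /(_ isT); rewrite mulrA ler_pdivlMr //; nra.
move=> cM c0 k; elim: k c cM c0 => [|k IH] c cM c0; first exact: head.
apply: (IH (fun j => c j.+1)) => [j|y yI]; first exact: cM.
have /andP[y0 _] := yI.
rewrite -[X in _ --> X](mulr0 y^-1).
rewrite (_ : series _ = fun n => y^-1 * series (fun k => c k * y ^+ k) n.+1).
  by apply: cvgMr; rewrite (cvg_shiftS (series (fun k => c k * y ^+ k))); exact: c0.
apply/funext => n; rewrite /series /= big_nat_recl // (head c) // mul0r add0r mulr_sumr.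
by apply: eq_bigr => j _; rewrite exprS; field; rewrite gt_eqF.
Unshelve. all: by end_near.
Qed.

Lemma series_exp (x : R) : series (fun k => x ^+ k / k`!%:R) @ \oo --> expR x.
Proof. exact: is_cvg_series_exp_coeff. Qed.

End PowerSeries.

(** * Poisson and Bernoulli generating functions *)

Section Distributions.
Context d (T : measurableType d) (R : realType) (P : probability T R).

(** At [rate = 0] the formula survives because [0 ^+ 0 = 1]. This rate does occur: the innovation at
    [v] degenerates when [alpha] attains the bound [sqrt (lambda_v / lambda_u)], where [u] is the
    parent of [v]. *)
Lemma poisson_prob_set1 (rate : R) k : 0 <= rate ->
  fine (poisson_prob rate 0%N [set k]) = rate ^+ k / k`!%:R * expR (- rate).
Proof.
rewrite le_eqVlt /poisson_prob => /predU1P[<-|rate0].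
  rewrite ltxx diracE /= oppr0 expR0 mulr1.
  by case: k => [|k]; [rewrite mem_set // expr0 divr1|rewrite memNset // expr0n mul0r].
by rewrite rate0 esum_set1 ?lee_fin ?poisson_pmf_ge0 // /poisson_pmf rate0.
Qed.

Lemma poisson_pgf (rate : R) (L : {RV P >-> nat}) (y : R) : 0 <= rate ->
  `|y| <= 1 -> distribution P L =1 poisson_prob rate 0%N ->
  \int[P]_w y ^+ L w = expR (rate * (y - 1)).
Proof.
move=> rate0 y1 lawL; have mL : dmeasurable L by apply/dmeasurable_nat.
have yi := integrable_Xn P y1 mL.
apply: (cvg_unique _ (series_Rintegral_comp (g := fun k => y ^+ k) mL yi)) => //=.
rewrite mulrBr mulr1 expRD.
rewrite (_ : series _ =
    fun n => series (fun k => (rate * y) ^+ k / k`!%:R) n * expR (- rate)).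
  by apply: cvgMl; exact: series_exp.
apply/funext => n; rewrite /series /= mulr_suml; apply: eq_bigr => k _.
rewrite -[P _]/(distribution P L [set k]) lawL poisson_prob_set1 // exprMn; ring.
Qed.

Lemma bernoulli_pgf (theta : R) (X : {RV P >-> bool}) (y : R) :
  0 <= theta <= 1 -> distribution P X =1 bernoulli_prob theta ->
  \int[P]_w y ^+ X w = 1 - theta + theta * y.
Proof.
move=> theta01 lawX.
have mX b : measurable [set w | X w = b].
  by rewrite -[X in measurable X]setTI; exact: (measurable_funP X measurableT [set b]).
have Pb b : fine (P [set w | X w = b]) = if b then theta else 1 - theta.
  rewrite -[P _]/(distribution P X [set b]) lawX /bernoulli_prob theta01.
  by rewrite fsbig_set1.
rewrite (_ : [set: T] = [set w | X w = true] `|` [set w | X w = false]); last first.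
  by apply/seteqP; split=> // w _ /=; case: (X w); [left|right].
rewrite Rintegral_setU //.
- rewrite (@Rintegral_const_on _ _ _ _ _ _ y) //; last by move=> w /= ->.
  rewrite (@Rintegral_const_on _ _ _ _ _ _ 1) //; last by move=> w /= ->.
  by rewrite !Pb; ring.
- apply: (@bounded_integrable _ _ _ _ _ _ (`|y| + 1)); first exact: measurableU.
    exact: (measurable_dcomp (fun b : bool => y ^+ b)).
  by move=> w; case: (X w); rewrite ?expr1 ?expr0 ?normr1 ?lerDl ?lerDr.
- by apply/disj_setPS => w [/= ->].
Qed.

End Distributions.

(** * Rooted trees *)

Section TreeFacts.
Context (V : finType) (e : rel V) (tree_e : is_tree e).

Lemma tree_sym u v : e u v = e v u.
Proof. by have [s _ _ _] := tree_e; rewrite s. Qed.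

Lemma tree_irr u : e u u = false.
Proof. by have [_ s _ _] := tree_e; rewrite s. Qed.

Lemma tree_path r v : exists p, [/\ path e r p, last r p = v & uniq (r :: p)].
Proof.
have [p [pp lp up _]] := on_path_refl r v tree_e.
by exists p.
Qed.

Lemma on_pathE r v p u : path e r p -> last r p = v -> uniq (r :: p) ->
  on_path e r u v <-> u \in r :: p.
Proof.
move=> pp lp up; split=> [[q [qp lq uq]]|up']; last by exists p.
by rewrite (tree_path_uniq tree_e qp pp) // lq.
Qed.

Lemma on_path_root r v : on_path e r r v.
Proof. by have [p [pp lp up]] := tree_path r v; exists p; rewrite mem_head. Qed.

Lemma in_ch r u v : v \in ch e r u <-> e u v /\ on_path e r u v.
Proof. by rewrite inE; split=> [/andP[-> /asboolW]|[-> /asboolP]]. Qed.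

Lemma root_notin_ch r u : r \notin ch e r u.
Proof.
apply/negP => /in_ch[eur our].
have := on_path_anti tree_e our (on_path_root r u); move=> ur.
by rewrite ur tree_irr in eur.
Qed.

Lemma exists_parent r v : v != r -> exists u, v \in ch e r u.
Proof.
move=> vr; have [p [pp lp up]] := tree_path r v.
case/lastP: p pp lp up => [|p x]; first by move=> _ /= rv; rewrite rv eqxx in vr.
rewrite rcons_path last_rcons => /andP[pp ex] xv; rewrite xv in ex *.
move=> up; exists (last r p); apply/in_ch; split=> //.
exists (rcons p v); rewrite rcons_path pp ex last_rcons; split=> //.
by rewrite -rcons_cons mem_rcons inE mem_last orbT.
Qed.

(** A child of [w] is not on the path from the root to [w], so appending [v] to the path of either
    parent gives a simple path to [v]; the two paths agree, hence so do their last but one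
    vertices. *)
Lemma parent_uniq r u u' v : v \in ch e r u -> v \in ch e r u' -> u = u'.
Proof.
have key w : v \in ch e r w -> exists p, [/\ path e r (rcons p v),
    uniq (r :: rcons p v) & last r p = w].
  move=> /in_ch[ewv ow]; have [q [qp lq uq]] := tree_path r w.
  have vq : v \notin r :: q.
    apply/negP => vq; have vw : on_path e r v w by exists q.
    by move: ewv; rewrite (on_path_anti tree_e ow vw) tree_irr.
  exists q; split=> //; first by rewrite rcons_path qp lq.
  by rewrite -rcons_cons rcons_uniq vq.
move=> /key[p [pp up <-]] /key[q [qp uq <-]].
have /rcons_inj[-> //] : rcons p v = rcons q v.
by apply: (tree_path_uniq tree_e pp qp); rewrite ?last_rcons.
Qed.

Lemma ch_pa r u v : v \in ch e r u -> pa e r v = u.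
Proof.
move=> vu; rewrite /pa; case: pickP => [w vw|/(_ u)]; last by rewrite vu.
exact: parent_uniq vw vu.
Qed.

Lemma in_ch_pa r v : v != r -> v \in ch e r (pa e r v).
Proof. by move=> /exists_parent[u vu]; rewrite (ch_pa vu). Qed.

(** Counted through the set of ancestors, so that its growth along an edge is a proper inclusion; it
    orders the inductions from the root downwards. *)
Definition depth r v := #|[set u | `[< on_path e r u v >]]%SET|.

Lemma depth_ch r u v : v \in ch e r u -> (depth r u < depth r v)%N.
Proof.
move=> vu; have /in_ch[euv ouv] := vu; apply/proper_card/properP; split.
  apply/fintype.subsetP => w; rewrite !inE => wu.
  exact: (on_path_trans tree_e wu ouv).
exists v; first by rewrite inE; apply/asboolP/on_path_refl.
rewrite inE; apply/negP => /asboolP vu'.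
by move: euv; rewrite (on_path_anti tree_e ouv vu') tree_irr.
Qed.

Lemma depth_pa r v : v != r -> (depth r (pa e r v) < depth r v)%N.
Proof. by move=> /in_ch_pa /depth_ch. Qed.

Lemma ch_edge r r' : e r r' -> r' \in ch e r r.
Proof. by move=> err'; apply/in_ch; split=> //; exact: on_path_root. Qed.

(** The path from [r'] to [v] comes from the one starting at [r], either by prepending [r'] or, when
    [r'] is already on it, by dropping [r]. In the second case [u] stays on the path, since [u = r]
    has been treated apart. *)
Lemma reroot_sub r r' u v : e r r' -> v \in ch e r u -> (u, v) != (r, r') ->
  v \in ch e r' u.
Proof.
move=> err' /in_ch[euv ouv] uvN; apply/in_ch; split=> //.
have r'r : r' != r by apply: contraTneq err' => ->; rewrite tree_irr.
have [ur|ur] := eqVneq u r.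
  subst u; exists [:: r; v]; rewrite /= !inE tree_sym err' euv eqxx orbT.
  rewrite !negb_or r'r !andbT /=; split=> //; apply/andP; split.
    by apply: contraNneq uvN => ->.
  by apply: contraTneq euv => ->; rewrite tree_irr.
have [p [pp lp up]] := tree_path r v.
have uin : u \in r :: p by apply/(on_pathE _ pp lp up).
have [r'p|r'p] := boolP (r' \in r :: p); last first.
  exists (r :: p); rewrite /= in pp lp up *.
  by rewrite tree_sym err' pp r'p up inE uin orbT.
case/splitPl: r'p pp lp up uin => q q2 lq.
rewrite cat_path last_cat lq -cat_cons cat_uniq => /andP[qp q2p] lq2.
move=> /and3P[uq disj uq2].
(* The edge from [r] to [r'] is the only simple path between them, so [r'] can only be the second
   vertex. *)
have qE : q = [:: r'].
  apply: (tree_path_uniq tree_e (x := r)) => //=; first by rewrite err'.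
  by rewrite inE eq_sym r'r.
subst q => uin; exists q2; split=> //; last first.
  by move: uin; rewrite !inE (negPf ur).
rewrite /= uq2 andbT; apply: contra disj => r'q; apply/hasP; exists r' => //.
by rewrite !inE eqxx orbT.
Qed.

Lemma reroot_ch r r' u v : e r r' -> (u, v) != (r, r') -> (u, v) != (r', r) ->
  (v \in ch e r u) = (v \in ch e r' u).
Proof.
move=> err' N N'; apply/idP/idP => h; first exact: (reroot_sub err').
by apply: (reroot_sub (r := r')); rewrite // tree_sym.
Qed.

Lemma edge_ind (Q : V -> Prop) r : Q r ->
  (forall u v, e u v -> Q u -> Q v) -> forall v, Q v.
Proof.
move=> Qr Qe v; have [p [pp <- _]] := tree_path r v.
elim: p r Qr pp => //= x p IH r Qr /andP[rx px].
exact: IH (Qe _ _ rx Qr) px.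
Qed.

(** [A] is closed under children, so a recursion started in [A] never leaves it; both values use the
    cut-off [#|V|] and are compared level by level. *)
Lemma tree_eta_ext (R : pzRingType) (A : {set V}) r r' (t t' th th' : V -> R) :
  {in A, forall u, ch e r u = ch e r' u} -> {in A, forall u, ch e r u \subset A} ->
  {in A, t =1 t'} -> {in A, th =1 th'} ->
  {in A, tree_eta e r t th =1 tree_eta e r' t' th'}.
Proof.
move=> chE chA tE thE u uA; rewrite /tree_eta.
elim: #|V| u uA => //= n IH u uA; rewrite tE // chE //; congr (_ * _).
apply: eq_bigr => j; rewrite -chE // => ju.
by have jA := fintype.subsetP (chA u uA) _ ju; rewrite thE // IH.
Qed.

End TreeFacts.

(** * The logarithm of the generating function and its invariance under rerooting *)

Section ModelFacts.
Context (R : realType) (V : finType) (e : rel V) (tree_e : is_tree e).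
Context (lambda : V -> R) (alpha : V -> V -> R) (adm : admissible e lambda alpha).
Local Notation theta := (thinning_par e lambda alpha).
Local Notation mu := (innovation_par e lambda alpha).

(** Both sides equal [sqrt (a * b)]. With symmetric [alpha] this is the balance between the two
    thinning parameters of an edge on which rerooting rests. *)
Lemma mul_sqrt_ratio (a b : R) : 0 < a -> 0 < b ->
  a * Num.sqrt (b / a) = b * Num.sqrt (a / b).
Proof.
have key (c c' : R) : 0 < c -> 0 < c' -> c * Num.sqrt (c' / c) = Num.sqrt (c * c').
  move=> c0 c'0; rewrite -{1}(ger0_norm (ltW c0)) -sqrtr_sqr -sqrtrM ?sqr_ge0 //.
  by congr Num.sqrt; field; rewrite gt_eqF.
by move=> a0 b0; rewrite !key // mulrC.
Qed.

Lemma lambda_gt0 v : 0 < lambda v.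
Proof. by have [h _ _] := adm. Qed.

Lemma thinning_par_ch r u v : v \in ch e r u ->
  theta r v = alpha u v * Num.sqrt (lambda v / lambda u).
Proof. by move=> vu; rewrite /thinning_par (ch_pa tree_e vu). Qed.

(** Rates add up to [lambda v]: the thinned parent contributes [lambda u * theta r v], the
    innovation the remainder. *)
Lemma innovation_par_ch r u v : v \in ch e r u ->
  mu r v = lambda v - lambda u * theta r v.
Proof.
move=> vu; rewrite (thinning_par_ch vu) /innovation_par (ch_pa tree_e vu).
have := mul_sqrt_ratio (lambda_gt0 u) (lambda_gt0 v).
move=> h; rewrite mulrBr mulr1 [lambda u * (_ * _)]mulrCA h; ring.
Qed.

(** Of the two bounds on [alpha], the one by [sqrt (lambda_u / lambda_v)], with [u] the parent,
    makes the thinning parameter a probability; the other makes the innovation rate nonnegative. *)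
Lemma thinning_par_bounds r v : v != r -> 0 <= theta r v <= 1.
Proof.
move=> vr; have vu := in_ch_pa tree_e vr; set u := pa e r v in vu *.
rewrite (thinning_par_ch vu); have /in_ch[euv _] := vu.
have [_ _ /(_ _ _ euv)/andP[a0]] := adm; rewrite le_min => /andP[a1 _].
rewrite mulr_ge0 ?sqrtr_ge0 ?(ltW a0) //=.
apply: le_trans (ler_wpM2r (sqrtr_ge0 _) a1) _.
have lu := lambda_gt0 u; have lv := lambda_gt0 v.
rewrite -sqrtrM; last by rewrite divr_ge0 ?ltW.
rewrite (_ : _ / _ * _ = 1) ?sqrtr1 //.
by field; rewrite !gt_eqF.
Qed.

Lemma innovation_par_ge0 r v : v != r -> 0 <= mu r v.
Proof.
move=> vr; have vu := in_ch_pa tree_e vr; set u := pa e r v in vu *.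
have /in_ch[euv _] := vu.
have [_ _ /(_ _ _ euv)/andP[a0]] := adm; rewrite le_min => /andP[_ a1].
have lu := lambda_gt0 u; have lv := lambda_gt0 v.
rewrite /innovation_par (ch_pa tree_e vu) mulr_ge0 ?(ltW lv) // subr_ge0.
apply: le_trans (ler_wpM2r (sqrtr_ge0 _) a1) _.
rewrite -sqrtrM; last by rewrite divr_ge0 ?ltW.
rewrite (_ : _ / _ * _ = 1) ?sqrtr1 //.
by field; rewrite !gt_eqF.
Qed.

Lemma convex_norm_le1 (th y : R) : 0 <= th <= 1 -> `|y| <= 1 ->
  `|1 - th + th * y| <= 1.
Proof.
move=> /andP[t0 t1] y1; apply: le_trans (ler_normD _ _) _.
rewrite normrM (ger0_norm t0) (@ger0_norm _ (1 - th)) ?subr_ge0 //.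
by have := ler_wpM2l t0 y1; lra.
Qed.

Lemma tree_eta_norm_le1 r (x : V -> R) v : (forall u, `|x u| <= 1) ->
  `|tree_eta e r x (theta r) v| <= 1.
Proof.
move=> x1; rewrite /tree_eta; elim: #|V| v => [|n IH] v /=; first by rewrite normr0.
rewrite normrM mulr_ile1 // normr_prod; apply: prodr_ile1 => j ju.
rewrite normr_ge0 convex_norm_le1 ?IH // thinning_par_bounds //.
by apply: contraTneq ju => ->; exact: root_notin_ch.
Qed.

Definition log_pgf r (x : V -> R) : R :=
  lambda r * (tree_eta e r x (theta r) r - 1) +
  \sum_(v | v != r) mu r v * (tree_eta e r x (theta r) v - 1).

Section Reroot.
Variables (r r' : V) (x : V -> R).
Hypothesis err' : e r r'.

(** Off the edge that carries the two roots nothing depends on the choice between them: children,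
    parents and therefore [eta] agree. *)
Let A : {set V} := ~: [set r; r']%SET.

Let r'r : r' != r.
Proof. by apply: contraTneq err' => ->; rewrite tree_irr. Qed.

Let AN u : u \in A -> u != r /\ u != r'.
Proof. by rewrite !inE negb_or => /andP[]. Qed.

Lemma reroot_ch_off : {in A, forall u, ch e r u = ch e r' u}.
Proof.
move=> u /AN[ur ur']; apply/setP => v; apply: reroot_ch => //.
  by apply: contraNneq ur => -[->].
by apply: contraNneq ur' => -[->].
Qed.

Lemma ch_off : {in A, forall u, ch e r u \subset A}.
Proof.
move=> u /AN[ur ur']; apply/fintype.subsetP => v vu; rewrite !inE negb_or.
apply/andP; split; apply: contraTneq vu => ->; first exact: root_notin_ch.
apply/negP => r'u; move: ur.
by rewrite (parent_uniq tree_e r'u (ch_edge tree_e err')) eqxx.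
Qed.

Lemma pa_off : {in A, forall v, pa e r v = pa e r' v}.
Proof.
move=> v /AN[vr vr']; apply/esym/(ch_pa tree_e); rewrite -(reroot_ch tree_e err').
- exact: in_ch_pa.
- by apply: contraNneq vr' => -[_ ->].
- by apply: contraNneq vr => -[_ ->].
Qed.

Lemma thinning_par_off : {in A, theta r =1 theta r'}.
Proof. by move=> v vA; rewrite /thinning_par pa_off. Qed.

Lemma tree_eta_off :
  {in A, tree_eta e r x (theta r) =1 tree_eta e r' x (theta r')}.
Proof.
apply: tree_eta_ext => //; [exact: reroot_ch_off|exact: ch_off|].
exact: thinning_par_off.
Qed.

(** Rooted at [r'], the vertex [r] keeps all its children but [r']; restoring that child multiplies
    by its factor. Both root values are thus expressed by the values of the two branches on either
    side of the edge. *)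
Lemma tree_eta_root_split :
  tree_eta e r x (theta r) r = tree_eta e r' x (theta r') r *
    (1 - theta r r' + theta r r' * tree_eta e r x (theta r) r').
Proof.
rewrite tree_eta_rec // (bigD1 r') ?ch_edge //=.
rewrite [tree_eta e r' x _ r]tree_eta_rec // -[RHS]mulrA; congr (_ * _).
rewrite mulrC; congr (_ * _).
have jE j : (j \in ch e r r) && (j != r') = (j \in ch e r' r).
  have [->|jr'] := eqVneq j r'.
    by rewrite andbF; apply/esym/negbTE/root_notin_ch.
  rewrite andbT (reroot_ch tree_e err') //.
    by apply: contraNneq jr' => -[->].
  by apply: contraNneq r'r => -[->].
apply: eq_big => // j /andP[jr jr'].
have jA : j \in A.
  rewrite !inE negb_or jr' andbT; apply: contraTneq jr => ->.
  exact: root_notin_ch.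
by rewrite thinning_par_off // tree_eta_off.
Qed.

Lemma log_pgf_adjE : log_pgf r x =
  lambda r * (tree_eta e r x (theta r) r - 1) +
  mu r r' * (tree_eta e r x (theta r) r' - 1) +
  \sum_(v in A) mu r v * (tree_eta e r x (theta r) v - 1).
Proof.
rewrite /log_pgf (bigD1 r') //= addrA; congr (_ + _).
by apply: eq_bigl => v; rewrite !inE negb_or.
Qed.

End Reroot.

Lemma log_pgf_adj r r' x : e r r' -> log_pgf r x = log_pgf r' x.
Proof.
move=> err'; have er'r : e r' r by rewrite tree_sym.
rewrite (log_pgf_adjE _ err') (log_pgf_adjE _ er'r).
have setE : [set r; r']%SET = [set r'; r]%SET by rewrite finset.setUC.
congr (_ + _); last first.
  rewrite -setE; apply: eq_bigr => v vA.
  by rewrite (tree_eta_off x err') // /innovation_par (pa_off err').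
rewrite (tree_eta_root_split x err') (tree_eta_root_split x er'r).
rewrite (innovation_par_ch (ch_edge tree_e err')) (innovation_par_ch (ch_edge tree_e er'r)).
have : lambda r * theta r r' = lambda r' * theta r' r.
  rewrite (thinning_par_ch (ch_edge tree_e err')) (thinning_par_ch (ch_edge tree_e er'r)).
  have [_ /(_ _ _ err') -> _] := adm.
  by rewrite mulrCA mul_sqrt_ratio ?lambda_gt0 // mulrCA.
set a := tree_eta e r' x _ r; set b := tree_eta e r x _ r' => h.
(* This form is symmetric: exchanging the roots swaps [a] and [b], and [h] matches the coefficients
   of the last term. *)
transitivity (lambda r * (a - 1) + lambda r' * (b - 1) +
   (lambda r * theta r r') * (a * b - a - b + 1)); first ring.
rewrite h; ring.
Qed.

Lemma log_pgf_root r r' x : log_pgf r x = log_pgf r' x.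
Proof.
apply: (@edge_ind _ _ tree_e (fun v => log_pgf r x = log_pgf v x) r) => // u v euv ->.
exact: log_pgf_adj.
Qed.

(** The root is nobody's child, so its variable enters only the value of [eta] at the root
    itself. *)
Lemma tree_eta_root_ext v (x x' : V -> R) : (forall u, u != v -> x u = x' u) ->
  forall u, u != v -> tree_eta e v x (theta v) u = tree_eta e v x' (theta v) u.
Proof.
move=> xx' u uv; apply: (@tree_eta_ext _ e _ [set~ v]%SET) => //.
- move=> w _; apply/fintype.subsetP => j jw; rewrite !inE.
  by apply: contraTneq jw => ->; exact: root_notin_ch.
- by move=> w; rewrite !inE => /xx'.
- by rewrite !inE.
Qed.

End ModelFacts.

(** * The generating function of the construction *)

Section Sigma.
Context d (T : measurableType d) (R : realType) (P : probability T R).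

Lemma dmeasurable_sum (I : Type) (s : seq I) (f : I -> T -> nat) :
  (forall i, dmeasurable (f i)) -> dmeasurable (fun w => (\sum_(i <- s) f i w)%N).
Proof.
move=> mf; apply/dmeasurable_nat; elim: s => [|i s IH].
  by under eq_fun do rewrite big_nil; exact: measurable_cst.
under eq_fun do rewrite big_cons.
by apply: measurable_fun_addn => //; exact/dmeasurable_nat.
Qed.

(** On [T] with the generated sigma-algebra each [X i] is measurable by construction; the usual
    measurability lemmas then place the events defined by sums and tuples of the [X i] in
    [sigma_rvs]. *)
Lemma sigma_rvs_dmeasurable d' (E : measurableType d') (I : Type) (D : set I)
    (X : I -> T -> E) i : (forall a : E, measurable [set a]) -> D i ->
  @dmeasurable _ (g_sigma_algebraType
    (\bigcup_(i in D) preimage_set_system setT (X i) measurable)) _ (X i).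
Proof.
move=> mE Di a; apply: sub_sigma_algebra; exists i => //; exists [set a] => //.
by rewrite setTI.
Qed.

Lemma Rintegral_norm_le1 (f : T -> R) : measurable_fun setT f ->
  (forall w, `|f w| <= 1) -> `|\int[P]_w f w| <= 1.
Proof.
move=> mf f1.
have fi : P.-integrable setT (EFin \o f) by exact: bounded_integrable f1.
have c1 : P.-integrable setT (EFin \o (fun=> 1 : R)).
  exact: finite_measure_integrable_cst.
apply: le_trans (le_normr_Rintegral measurableT fi) _.
apply: (@le_trans _ _ (\int[P]_w (1 : R))).
  by apply: le_Rintegral => //; exact: integrable_norm fi.
rewrite (Rintegral_cst P measurableT) mul1r -lee_fin fineK ?fin_num_measure //.
exact: probability_le1.
Qed.

Lemma eq_Rintegral_fibers (C : countType) (U : T -> C) (f g : T -> R) :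
  dmeasurable U -> P.-integrable setT (EFin \o f) ->
  P.-integrable setT (EFin \o g) ->
  (forall c, \int[P]_(w in [set w | U w = c]) f w =
             \int[P]_(w in [set w | U w = c]) g w) ->
  \int[P]_w f w = \int[P]_w g w.
Proof.
move=> mU fi gi fg.
have [] // := @cond_Rintegral _ _ _ P _ U f g (fun w => `|f w|) mU.
- by have [/measurable_EFinP] := integrableP _ _ _ fi.
- exact: integrable_norm fi.
- by move=> c; apply: integrableS fi.
Qed.

Lemma indep_prod (I : choiceType) (D : set I) (F : I -> set (set T))
    (Y : I -> T -> nat) (g : I -> nat -> R) (s : seq I) :
  indep_events P D F -> uniq s -> {in s, forall i, D i} ->
  {in s, forall i k, F i [set w | Y i w = k]} ->
  {in s, forall i, dmeasurable (Y i)} ->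
  {in s, forall i, P.-integrable setT (EFin \o (fun w => g i (Y i w)))} ->
  P.-integrable setT (EFin \o (fun w => \prod_(i <- s) g i (Y i w))) /\
  \int[P]_w \prod_(i <- s) g i (Y i w) = \prod_(i <- s) \int[P]_w g i (Y i w).
Proof.
move=> indep us Ds FY mY gi.
have := @indep_prod_setI _ _ _ P _ D F Y g s [::] (fun=> setT) indep.
rewrite cats0 big_nil mulr1 => /(_ us Ds FY mY gi).
rewrite (_ : \bigcap_(i in _) _ = setT); first by apply.
by apply/seteqP; split=> // w _ i.
Qed.

Lemma preimage_system_set1 (Y : T -> nat) k :
  preimage_set_system setT Y measurable [set w | Y w = k].
Proof. by exists [set k] => //; rewrite setTI. Qed.

End Sigma.

Section Construction.
Context (R : realType) (V : finType) (e : rel V) (tree_e : is_tree e).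
Context (lambda : V -> R) (alpha : V -> V -> R) (adm : admissible e lambda alpha).
Context d (T : measurableType d) (P : probability T R) (r : V).
Context (N : V -> T -> nat) (L : V -> {RV P >-> nat}).
Context (Ber : V -> nat -> {RV P >-> bool}).
Hypothesis N_constr : MPMRF_construction e lambda alpha r N L Ber.

Local Notation theta := (thinning_par e lambda alpha r).
Local Notation mu := (innovation_par e lambda alpha r).
Local Notation parent := (pa e r).

(** With a fixed number [m] of trials this depends on the Bernoulli sequence alone, to which
    independence applies; the actual thinning is recovered at [m = N (parent v) w]. *)
Let thin v m (w : T) : nat := (\sum_(j < m) Ber v j w)%N.

Let N_root w : N r w = L r w.
Proof. by have [_ _ h _] := N_constr; exact: h. Qed.

Let N_step v w : v != r -> N v w = (thin v (N (parent v) w) w + L v w)%N.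
Proof. by have [_ _ _ h] := N_constr => vr; exact: h. Qed.

Let mBer v j : dmeasurable (fun w => nat_of_bool (Ber v j w)).
Proof.
apply: (dmeasurable_comp nat_of_bool) => b.
rewrite -[X in measurable X]setTI.
exact: (measurable_funP (Ber v j) measurableT [set b]).
Qed.

Let mthin v m : dmeasurable (thin v m).
Proof. exact: dmeasurable_sum. Qed.

Let mL v : dmeasurable (L v).
Proof. exact/dmeasurable_nat. Qed.

(** The construction gives [N] as mere functions, so measurability is derived from the recursion, by
    induction on the depth. *)
Lemma dmeasurable_MPMRF v : dmeasurable (N v).
Proof.
have [n] := ubnP (depth e r v); elim: n v => // n IH v vn.
have [->|vr] := eqVneq v r.
  by rewrite (_ : N r = L r) //; apply/funext => w; exact: N_root.
rewrite (_ : N v = fun w => (thin v (N (parent v) w) w + L v w)%N); last first.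
  by apply/funext => w; exact: N_step.
apply: (dmeasurable_glue (U := N (parent v)) (f := fun m w => (thin v m w + L v w)%N)).
  by apply: IH; apply: leq_trans (depth_pa tree_e vr) _.
by move=> m; apply/dmeasurable_nat/measurable_fun_addn; apply/dmeasurable_nat.
Qed.

Lemma thinning_pgf v m (z : R) : v != r -> `|z| <= 1 ->
  \int[P]_w z ^+ thin v m w = (1 - theta v + theta v * z) ^+ m.
Proof.
move=> vr z1; have [[_ _ Ber_law] [_ Ber_indep _] _ _] := N_constr.
transitivity (\int[P]_w \prod_(0 <= j < m) z ^+ nat_of_bool (Ber v j w)).
  by apply: eq_Rintegral => w _; rewrite big_mkord expr_sum.
have FY : {in index_iota 0 m, forall j k,
    preimage_set_system setT (Ber v j) measurable
      [set w | nat_of_bool (Ber v j w) = k]}.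
  move=> j _ k; exists [set b : bool | nat_of_bool b = k] => //.
  by rewrite setTI.
have zi : {in index_iota 0 m, forall j,
    P.-integrable setT (EFin \o (fun w => z ^+ nat_of_bool (Ber v j w)))}.
  by move=> j _; exact: integrable_Xn.
have [_ ->] := @indep_prod _ _ _ P nat setT _ (fun j w => nat_of_bool (Ber v j w))
  (fun _ k => z ^+ k) _ (Ber_indep v vr) (iota_uniq _ _)
  (fun _ _ => I) FY (fun j _ => @mBer v j) zi.
rewrite big_mkord (eq_bigr (fun=> 1 - theta v + theta v * z)).
  by rewrite prodr_const card_ord.
by move=> j _; apply: bernoulli_pgf; [exact: thinning_par_bounds|exact: Ber_law].
Qed.

(** The innovations enter jointly, through the single event that fixes all of them, because the
    thinnings are independent of the family [L] as a whole, which has the index [None]. *)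
Let indep_thin_L (m : V -> nat) (g : V -> nat -> R) (l : {ffun V -> nat}) :
  (forall v k, `|g v k| <= 1) ->
  \int[P]_(w in [set w | [ffun v => L v w] = l])
     \prod_(v | v != r) g v (thin v (m v) w) =
  \prod_(v | v != r) \int[P]_w g v (thin v (m v) w) *
  fine (P [set w | [ffun v => L v w] = l]).
Proof.
move=> g1; have [_ [_ _ indep] _ _] := N_constr.
have ml : measurable [set w | [ffun v => L v w] = l].
  exact: (dmeasurable_finfun mL).
pose Y (o : option V) := if o is Some v then thin v (m v) else fun=> 0%N.
pose s1 := [seq Some v | v <- enum [pred v | v != r]].
have Ds : {in s1 ++ [:: None],
    forall o : option V, [set o | if o is Some v then v != r else True] o}.
  move=> [v|] //; rewrite mem_cat inE orbF => /mapP[u].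
  by rewrite mem_enum inE /= => ur [->].
have us : uniq (s1 ++ [:: None]).
  have Some_inj : injective (@Some V) by move=> u v [].
  rewrite cat_uniq (map_inj_uniq Some_inj) enum_uniq /= orbF andbT.
  by apply/negP => /mapP[].
have mY o : dmeasurable (Y o).
  case: o => [v|]; first exact: mthin.
  by apply/dmeasurable_nat; exact: measurable_cst.
have gY o k : `|(if o is Some v then g v k else 1)| <= 1.
  by case: o => [v|]; rewrite ?normr1.
have FY : {in s1, forall o k,
    (if o is Some v then sigma_rvs setT (fun j => Ber v j : T -> bool)
     else sigma_rvs setT (fun v => L v : T -> nat)) [set w | Y o w = k]}.
  move=> [v|] os k; last by case/mapP: os.
  apply: (@dmeasurable_sum _ (g_sigma_algebraType (\bigcup_(j in setT)
    preimage_set_system setT (Ber v j : T -> bool) measurable)) _ _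
    (fun (j : 'I_(m v)) w => nat_of_bool (Ber v j w))) => j.
  apply: (@dmeasurable_comp _ _ bool _ _ nat_of_bool).
  exact: (@sigma_rvs_dmeasurable _ T _ bool nat setT (fun j => Ber v j : T -> bool) j).
have gi : {in s1, forall o, P.-integrable setT (EFin \o
    (fun w => (if o is Some v then g v (Y o w) else 1)))}.
  move=> o _; apply: (@bounded_integrable _ _ _ _ _ _ 1) => //.
  exact: (measurable_dcomp (fun k => if o is Some v then g v k else 1)).
have FA : {in [:: None : option V], forall o,
    (if o is Some v then sigma_rvs setT (fun j => Ber v j : T -> bool)
     else sigma_rvs setT (fun v => L v : T -> nat))
    [set w | [ffun v => L v w] = l]}.
  move=> o; rewrite inE => /eqP ->.
  apply: (@dmeasurable_finfun _ (g_sigma_algebraType (\bigcup_(v in setT)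
    preimage_set_system setT (L v : T -> nat) measurable)) V nat
    (fun v => L v : T -> nat)) => v.
  exact: sigma_rvs_dmeasurable.
have [_] := @indep_prod_setI _ _ _ P _ _ _ Y
  (fun o k => if o is Some v then g v k else 1)
  s1 [:: None] (fun=> [set w | [ffun v => L v w] = l]) indep us Ds FY
  (fun o _ => mY o) gi FA (fun _ _ => ml).
rewrite big_seq1 big_map big_enum /=.
rewrite (_ : \bigcap_(i in _) _ = [set w | [ffun v => L v w] = l]); last first.
  apply/seteqP; split=> w; last by move=> Lw i _.
  by move/(_ None); apply; rewrite /= inE.
move=> <-; apply: eq_Rintegral => w _.
by rewrite big_map big_enum.
Qed.

(* The hypothesis [m r = 0] disables the thinning at the root, where [Ber r] is
   not assumed independent of anything. *)
Lemma indep_thin_innov (m : V -> nat) (g : V -> nat -> nat -> R) :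
  m r = 0%N -> (forall v c l, `|g v c l| <= 1) ->
  \int[P]_w \prod_v g v (thin v (m v) w) (L v w) =
  \prod_v \int[P]_w (if v == r then g r 0%N (L r w)
                     else \int[P]_w' g v (thin v (m v) w') (L v w)).
Proof.
move=> mr g1; have [_ [L_indep _ _] _ _] := N_constr.
pose h v l := if v == r then g r 0%N l else \int[P]_w' g v (thin v (m v) w') l.
have mg v l : measurable_fun setT (fun w => g v (thin v (m v) w) l).
  exact: (measurable_dcomp (fun c => g v c l)).
have h1 v l : `|h v l| <= 1.
  by rewrite /h; case: ifP => _ //; exact: Rintegral_norm_le1.
have mh v : measurable_fun setT (fun w => h v (L v w)) by exact: measurable_dcomp.
have prod1 (f : V -> R) : (forall v, `|f v| <= 1) -> `|\prod_v f v| <= 1.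
  by move=> f1; rewrite normr_prod; apply: prodr_ile1 => v _; rewrite normr_ge0 f1.
have mU : dmeasurable (fun w => [ffun v => L v w]) by exact: dmeasurable_finfun.
have hi : P.-integrable setT (EFin \o (fun w => \prod_v h v (L v w))).
  apply: (@bounded_integrable _ _ _ _ _ _ 1) => //.
    by apply: measurable_prod => v _.
  by move=> w; apply: prod1.
(* Two stages: with the innovations frozen, each thinning is averaged out, which gives [h]; the
   factors [h v (L v w)] then separate by independence of the innovations. *)
transitivity (\int[P]_w \prod_v h v (L v w)).
  apply: (eq_Rintegral_fibers mU _ hi) => [|l].
    apply: (@bounded_integrable _ _ _ _ _ _ 1) => //; last by move=> w; exact: prod1.
    apply: measurable_prod => v _.
    exact: (measurable_glue (f := fun k w => g v (thin v (m v) w) k)).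
  have ml := mU l.
  have gl w : [ffun v => L v w] = l -> \prod_v g v (thin v (m v) w) (L v w) =
      g r 0%N (l r) * \prod_(v | v != r) g v (thin v (m v) w) (l v).
    move=> <-; rewrite (bigD1 r) //= /thin mr big_ord0 ffunE; congr (_ * _).
    by apply: eq_bigr => v _; rewrite ffunE.
  transitivity (\int[P]_(w in [set w | [ffun v => L v w] = l])
      (g r 0%N (l r) * \prod_(v | v != r) g v (thin v (m v) w) (l v))).
    by apply: eq_Rintegral => w /[!inE] /gl.
  rewrite RintegralZl //; last first.
    apply: (@bounded_integrable _ _ _ _ _ _ 1) => //.
      rewrite (_ : (fun w => _) = fun w =>
        \prod_v (if v != r then g v (thin v (m v) w) (l v) else 1)).
        by apply: measurable_prod => v _; case: (v != r).
      by apply/funext => w; rewrite big_mkcond.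
    by move=> w; rewrite normr_prod; apply: prodr_ile1 => v _; rewrite normr_ge0 g1.
  rewrite (indep_thin_L m (g := fun v c => g v c (l v)) l) //.
  rewrite (@Rintegral_const_on _ _ _ _ _ _ (\prod_v h v (l v))) //; last first.
    by move=> w /= <-; apply: eq_bigr => v _; rewrite ffunE.
  rewrite [\prod_v h v (l v)](bigD1 r) //= mulrA; congr (_ * _ * _).
    by rewrite /h eqxx.
  by apply: eq_bigr => v vr; rewrite /h (negPf vr).
have [_ eqp] := @indep_prod _ _ _ P _ _ _ (fun v => L v : T -> nat) h (index_enum V)
  L_indep (index_enum_uniq _) (fun _ _ => I)
  (fun v _ k => preimage_system_set1 (L v) k) (fun v _ => @mL v)
  (fun v _ => @bounded_integrable _ _ _ P _ _ 1 measurableT (mh v) (fun w => h1 v _)).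
by rewrite eqp; apply: eq_bigr => v _; rewrite /h; case: eqP => [->|].
Qed.

Let mN := dmeasurable_MPMRF.

(** The conditional law of [N u] given [N] on [D], in integrated form. As [D] contains the parents
    of its vertices, [A] can be rewritten with thinnings of fixed counts and innovations at vertices
    of [D] only, all independent of those at [u]. *)
Lemma condition_MPMRF (D : {set V}) (u : V) (z : R) (n : V -> nat) :
  r \in D -> (forall v, v \in D -> v != r -> parent v \in D) ->
  u \notin D -> parent u \in D -> `|z| <= 1 ->
  let A := [set w | forall v, v \in D -> N v w = n v] in
  \int[P]_(w in A) z ^+ N u w =
  \int[P]_(w in A) (expR (mu u * (z - 1)) *
    (1 - theta u + theta u * z) ^+ n (parent u)).
Proof.
move=> rD Dpa uD upD z1 A.
have ur : u != r by apply: contraNneq uD => ->.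
pose m v := if v == r then 0%N else n (parent v).
have mr : m r = 0%N by rewrite /m eqxx.
have AE : A = [set w | forall v, v \in D -> (thin v (m v) w + L v w)%N = n v].
  apply/seteqP; split=> w /= Aw v.
    move=> vD; rewrite -Aw //; have [vr|vr] := eqVneq v r.
      by rewrite vr mr /thin big_ord0 N_root.
    by rewrite N_step // /m (negPf vr) Aw //; exact: Dpa.
  have [k] := ubnP (depth e r v); elim: k v => // k IH v vk vD.
  rewrite -(Aw v vD); have [vr|vr] := eqVneq v r.
    by rewrite vr mr /thin big_ord0 N_root.
  rewrite N_step // /m (negPf vr) IH //; last exact: Dpa.
  by apply: leq_trans (depth_pa tree_e vr) _.
have mA : measurable A.
  rewrite (_ : A = \bigcap_(v in [set` D]) [set w | N v w = n v]); last first.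
    by apply/seteqP; split.
  by apply: fin_bigcap_measurable => // v _; exact: mN.
(* The indicator of [A] times the power at [u] must be a product over vertices for independence to
   apply: one indicator for each vertex of [D], the power at [u], and 1 elsewhere. *)
pose g (y : R) v c l : R :=
  if v \in D then ((c + l)%N == n v)%:R else if v == u then y ^+ (c + l) else 1.
have g1 y : `|y| <= 1 -> forall v c l, `|g y v c l| <= 1.
  move=> y1 v c l; rewrite /g; case: ifP => _.
    by case: eqP; rewrite ?normr1 ?normr0.
  by case: ifP; rewrite ?normr1 // normrX exprn_ile1.
have gE y w : \prod_v g y v (thin v (m v) w) (L v w) =
    (fun w => y ^+ (thin u (m u) w + L u w)) \_ A w.
  rewrite AE patchE; case: ifPn => [/set_mem /= Aw|/negP wA].
    rewrite (bigD1 u) //= /g (negPf uD) eqxx big1 ?mulr1 // => v /negPf vu.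
    by rewrite vu; case: ifP => // vD; rewrite Aw // eqxx.
  have [v [vD vn]] : exists v, v \in D /\ (thin v (m v) w + L v w)%N != n v.
    apply: contrapT => h; apply: wA; rewrite inE /= => v vD; apply/eqP.
    by apply: contrapT => /negP vn; apply: h; exists v.
  by rewrite (bigD1 v) //= /g vD (negPf vn) mul0r.
have mfibre y : measurable_fun setT (fun w => y ^+ (thin u (m u) w + L u w) : R).
  by apply: measurable_Xn; apply/dmeasurable_nat/measurable_fun_addn; apply/dmeasurable_nat.
pose Q y := \prod_(v | v != u) \int[P]_w (if v == r then g y r 0%N (L r w)
  else \int[P]_w' g y v (thin v (m v) w') (L v w)).
have key (y : R) : `|y| <= 1 -> \int[P]_(w in A) y ^+ (thin u (m u) w + L u w) =
    (1 - theta u + theta u * y) ^+ n (parent u) * expR (mu u * (y - 1)) *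
    Q y.
  move=> y1; rewrite Rintegral_mkcond; under eq_Rintegral do rewrite -gE.
  rewrite (indep_thin_innov mr (g1 y y1)) (bigD1 u isT) /= /Q; congr (_ * _).
  rewrite (negPf ur) /g (negPf uD) eqxx /m (negPf ur).
  have [[_ L_law _] _ _ _] := N_constr.
  rewrite -(poisson_pgf (innovation_par_ge0 tree_e adm ur) y1 (L_law u ur)).
  rewrite -RintegralZl //; last first.
    exact: integrable_Xn.
  apply: eq_Rintegral => w _; rewrite -thinning_pgf //.
  rewrite -RintegralZr //; last first.
    exact: integrable_Xn.
  by apply: eq_Rintegral => w' _; rewrite exprD.
have AN : \int[P]_(w in A) z ^+ N u w =
    \int[P]_(w in A) z ^+ (thin u (m u) w + L u w).
  by apply: eq_Rintegral => w /[!inE] Aw; rewrite N_step // /m (negPf ur) Aw.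
rewrite AN (key z z1) (Rintegral_cst P mA).
(* At [y = 1] the same formula evaluates the probability of [A], so [Q] is eliminated without being
   computed. *)
have := key 1; rewrite normr1 => /(_ (lexx _)).
under eq_Rintegral do rewrite expr1n.
rewrite (Rintegral_cst P mA) mul1r => ->.
have -> : Q z = Q 1.
  apply: eq_bigr => v vu; apply: eq_Rintegral => w _.
  by case: ifP => _; rewrite /g ?rD ?(negPf vu).
by rewrite mulr1 subrK expr1n subrr mulr0 expR0 !mul1r [expR _ * _]mulrC.
Qed.

Let NX (z : V -> R) w := \prod_v z v ^+ N v w.

Let NX_int (z : V -> R) : (forall v, `|z v| <= 1) ->
  P.-integrable setT (EFin \o NX z).
Proof.
by move=> z1; exact: integrable_prod_Xn.
Qed.

(** Since the variables outside [D] and [u] equal 1, [u] acts as a leaf. The conditional mean of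
    [z u ^+ N u] given [N] on [D] is a constant times a power with exponent [N (parent u)], which
    the variable of the parent absorbs. *)
Lemma peel_leaf (D : {set V}) (u : V) (z : V -> R) :
  r \in D -> (forall v, v \in D -> v != r -> parent v \in D) ->
  u \notin D -> parent u \in D -> (forall v, `|z v| <= 1) ->
  (forall v, v \notin D -> v != u -> z v = 1) ->
  \int[P]_w \prod_v z v ^+ N v w = expR (mu u * (z u - 1)) *
  \int[P]_w \prod_v (if v == u then 1 else if v == parent u
              then z v * (1 - theta u + theta u * z u) else z v) ^+ N v w.
Proof.
move=> rD Dpa uD upD z1 zD.
have ur : u != r by apply: contraNneq uD => ->.
pose z' v := if v == u then 1 else
  if v == parent u then z v * (1 - theta u + theta u * z u) else z v.
change (\int[P]_w NX z w = expR (mu u * (z u - 1)) * \int[P]_w NX z' w).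
have z'1 v : `|z' v| <= 1.
  rewrite /z'; case: ifP => _; rewrite ?normr1 //; case: ifP => _ //.
  rewrite normrM mulr_ile1 // convex_norm_le1 //; exact: thinning_par_bounds.
(* The fibers of [N] restricted to [D], padded by 0 so as to be indexed by functions on all of
   [V]. *)
have mU : dmeasurable (fun w => [ffun v => if v \in D then N v w else 0%N]).
  apply: (dmeasurable_finfun (f := fun v w => if v \in D then N v w else 0%N)) => v.
  case: (v \in D) => //.
  by apply/dmeasurable_nat; exact: measurable_cst.
rewrite -RintegralZl //; last exact: NX_int.
apply: (eq_Rintegral_fibers mU) => [||n].
- exact: NX_int.
- rewrite (_ : EFin \o _ = fun w => ((expR (mu u * (z u - 1)))%:E * (NX z' w)%:E)%E) //.
  by apply: integrableZl => //; exact: NX_int.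
have [n0|nD] := pselect (forall v, v \notin D -> n v = 0%N); last first.
  rewrite (_ : mkset _ = set0) ?Rintegral_set0 //; apply/seteqP; split=> // w /= Un.
  by apply: nD => v vD; rewrite -Un ffunE (negPf vD).
pose c := \prod_(v in D) z v ^+ n v.
have AE : [set w | [ffun v => if v \in D then N v w else 0%N] = n] =
    [set w | forall v, v \in D -> N v w = n v].
  apply/seteqP; split=> w /= => [<- v vD|Aw]; first by rewrite ffunE vD.
  by apply/ffunP => v; rewrite ffunE; case: ifPn => [/Aw //|/n0 ->].
have mA := mU n; rewrite AE in mA *.
have split_prod (y : V -> R) w : (forall v, v \in D -> N v w = n v) ->
    (forall v, v \notin D -> v != u -> y v = 1) ->
    NX y w = (\prod_(v in D) y v ^+ n v) * y u ^+ N u w.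
  move=> Aw y1; rewrite /NX (bigID (mem D)) /=; congr (_ * _).
    by apply: eq_bigr => v /Aw ->.
  rewrite (bigD1 u) //= big1 ?mulr1 // => v /andP[vD vu].
  by rewrite y1 // expr1n.
transitivity (\int[P]_(w in [set w | forall v, v \in D -> N v w = n v])
    (c * z u ^+ N u w)).
  by apply: eq_Rintegral => w /[!inE] Aw; rewrite (split_prod z).
rewrite RintegralZl //; last first.
  by apply: integrableS (integrable_Xn P (z1 u) (mN u)).
rewrite (condition_MPMRF n rD Dpa uD upD (z1 u)) -RintegralZl //; last first.
  exact: integrable_const_on (fun w _ => erefl).
apply: eq_Rintegral => w /[!inE] Aw; rewrite (split_prod z') //; last first.
  move=> v vD vu; rewrite /z' (negPf vu) ifN ?zD //.
  by apply: contraNneq vD => ->.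
rewrite {2}/z' eqxx expr1n mulr1 mulrCA; congr (_ * _).
rewrite /c (bigD1 (parent u)) //= [RHS](bigD1 (parent u)) //=.
have pu : parent u != u by apply: contraNneq uD => {1}<-.
rewrite {1}/z' (negPf pu) eqxx exprMn mulrAC; congr (_ * _).
apply: eq_bigr => v /andP[vD vp]; rewrite /z' (negPf vp) ifN //.
by apply: contraNneq uD => <-.
Qed.

Lemma MPMRF_construction_pgf (x : V -> R) : (forall v, `|x v| <= 1) ->
  \int[P]_w \prod_v x v ^+ N v w = expR (log_pgf e lambda alpha r x).
Proof.
move=> x1; pose eta v := tree_eta e r x theta v.
pose factor v := 1 - theta v + theta v * eta v.
(* The variables left when all vertices outside [D] have been peeled off: each has collected the
   factors of its removed children. *)
pose z (D : {set V}) v := if v \in D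
  then x v * \prod_(j in ch e r v | j \notin D) factor j else 1.
have eta1 v : `|eta v| <= 1 by exact: tree_eta_norm_le1.
have ch_nr v j : j \in ch e r v -> j != r.
  by apply: contraTneq => ->; exact: root_notin_ch.
have z1 D v : `|z D v| <= 1.
  rewrite /z; case: ifP => _; rewrite ?normr1 // normrM mulr_ile1 // normr_prod.
  apply: prodr_ile1 => j /andP[/ch_nr jr _]; rewrite normr_ge0 convex_norm_le1 //.
  exact: thinning_par_bounds.
have peeled k (D : {set V}) : #|~: D| = k -> r \in D ->
    (forall v, v \in D -> v != r -> parent v \in D) ->
    \int[P]_w NX x w = \prod_(v in ~: D) expR (mu v * (eta v - 1)) *
      \int[P]_w NX (z D) w.
  elim: k D => [|k IH] D cD rD Dpa.
    have DT v : v \in D.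
      by have := cards0_eq cD; move/setP/(_ v); rewrite !inE => /negbT; rewrite negbK.
    rewrite big1 ?mul1r => [|v]; last by rewrite inE DT.
    apply: eq_Rintegral => w _; apply: eq_bigr => v _; rewrite /z DT big1 ?mulr1 //.
    by move=> j /andP[_]; rewrite DT.
  have [u0 u0D] : exists u, u \in ~: D by apply/card_gt0P; rewrite cD.
  (* A vertex of least depth outside [D] has its parent in [D], so [D'] is again closed under
     parents, and [u] is the leaf of [D'] to be peeled. *)
  have [u uDc umin] : exists2 u, u \in ~: D &
      forall v, v \in ~: D -> (depth e r u <= depth e r v)%N.
    by case: (arg_minnP (depth e r) u0D) => u; exists u.
  have uD : u \notin D by rewrite inE in uDc.
  have ur : u != r by apply: contraNneq uD => ->.
  have upD : parent u \in D.
    apply: contraT => upD; have := umin (parent u); rewrite inE upD => /(_ isT).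
    by rewrite leqNgt depth_pa.
  pose D' := (u |: D)%SET.
  have D'pa v : v \in D' -> v != r -> parent v \in D'.
    rewrite !inE => /predU1P[->|vD] vr; first by rewrite upD orbT.
    by rewrite (Dpa v vD vr) orbT.
  rewrite (IH D') //; last 2 first.
  - have := cardsC D; have := cardsC D'; rewrite cardsU1 uD cD /=; lia.
  - by rewrite !inE rD orbT.
  have ju_D' j : j \in ch e r u -> j \notin D'.
    move=> ju; rewrite !inE negb_or; apply/andP; split.
      by apply: contraTneq ju => ->; rewrite inE tree_irr.
    apply: contra uD => jD; rewrite -(ch_pa tree_e ju); apply: Dpa => //.
    exact: ch_nr ju.
  (* All children of [u] lie outside [D'] and have been collected, so the variable at [u] has become
     the full [eta u]. *)
  have zu : z D' u = eta u.
    rewrite /z !inE eqxx /= /eta tree_eta_rec //; congr (_ * _).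
    by apply: eq_bigl => j; case: (boolP (j \in _)) => //= /ju_D'.
  have pu : parent u != u by apply: contraNneq uD => {1}<-.
  have uup : u \in ch e r (parent u) by exact: in_ch_pa.
  have zE v : (if v == u then 1 else if v == parent u
      then z D' v * (1 - theta u + theta u * z D' u) else z D' v) = z D v.
    rewrite zu /z !inE; have [->|vu] := eqVneq v u; first by rewrite (negPf uD).
    rewrite /=; have [->|vp] := eqVneq v (parent u).
      rewrite upD -mulrA; congr (_ * _).
      rewrite [RHS](bigD1 u) ?uup //= mulrC; congr (_ * _); apply: eq_bigl => j.
      by rewrite -andbA; congr (_ && _); rewrite in_setU1 negb_or andbC.
    case: ifP => // vD; congr (_ * _); apply: eq_bigl => j; rewrite in_setU1 negb_or.
    have [->|//] := eqVneq j u; rewrite andbF; apply/esym/negbTE.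
    rewrite negb_and; apply/orP; left; apply: contra vp => uv.
    by rewrite (ch_pa tree_e uv).
  rewrite /NX (peel_leaf rD Dpa uD upD (z1 D')); last first.
    by move=> v vD vu; rewrite /z !inE (negPf vu) (negPf vD).
  under [X in _ * (_ * X) = _]eq_Rintegral => w _.
    under eq_bigr => v _ do rewrite zE.
    over.
  rewrite zu mulrCA mulrA; congr (_ * _).
  rewrite [RHS](bigD1 u) //=; congr (_ * _); apply: eq_bigl => v.
  by rewrite !inE negb_or andbC.
have := @peeled _ [set r]%SET erefl; rewrite set11 => -> //; last first.
  by move=> v; rewrite inE => ->.
rewrite /log_pgf expRD expR_sum mulrC; congr (_ * _); last first.
  by apply: eq_bigl => v; rewrite !inE.
have [[L_law _ _] _ _ _] := N_constr.
rewrite -(poisson_pgf (ltW (lambda_gt0 adm r)) (eta1 r) L_law).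
apply: eq_Rintegral => w _; rewrite /NX (bigD1 r) //= big1 ?mulr1.
  rewrite N_root /z set11 /eta tree_eta_rec //; congr ((_ * _) ^+ _).
  by apply: eq_bigl => j; rewrite inE; case: (boolP (j \in _)) => // /ch_nr ->.
by move=> v vr; rewrite /z inE (negPf vr) expr1n.
Qed.

End Construction.

(** * Conditioning on one vertex *)

Section MPMRFLaw.
Context (R : realType) (V : finType) (e : rel V) (tree_e : is_tree e).
Context (lambda : V -> R) (alpha : V -> V -> R) (adm : admissible e lambda alpha).
Context d (T : measurableType d) (P : probability T R).
Context (N : V -> {RV P >-> nat}).
Hypothesis N_law : MPMRF e lambda alpha P (fun v => N v : T -> nat).

Let mN v : dmeasurable (N v).
Proof. exact/dmeasurable_nat. Qed.

Let mNN : dmeasurable (fun w => [ffun v => N v w]).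
Proof. exact: dmeasurable_finfun. Qed.

Lemma MPMRF_pgf (v : V) (x : V -> R) : (forall u, `|x u| <= 1) ->
  \int[P]_w \prod_u x u ^+ N u w = expR (log_pgf e lambda alpha v x).
Proof.
move=> x1; have [d' [T' [P' [r [N' [L [Ber [constr law]]]]]]]] := N_law.
have mN' u : dmeasurable (N' u) by exact: (dmeasurable_MPMRF tree_e constr).
have mNN' : dmeasurable (fun w => [ffun u => N' u w]) by exact: dmeasurable_finfun.
rewrite (log_pgf_root tree_e adm v r) -(MPMRF_construction_pgf tree_e adm constr) //.
pose F (n : {ffun V -> nat}) := \prod_u x u ^+ n u.
have [] := @Rintegral_law _ T _ T' R P P' _ (fun w => [ffun u => N u w])
  (fun w => [ffun u => N' u w]) F mNN mNN'.
- move=> A; exact: (law [set f | A [ffun u => f u]]).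
- apply: (@bounded_integrable _ _ _ _ _ _ 1) => //; first exact: measurable_dcomp.
  by move=> w; exact: norm_prod_Xn_le1.
rewrite /F => _ FE.
transitivity (\int[P]_w \prod_u x u ^+ [ffun u => N u w] u).
  by apply: eq_Rintegral => w _; apply: eq_bigr => u _; rewrite ffunE.
by rewrite FE; apply: eq_Rintegral => w _; apply: eq_bigr => u _; rewrite ffunE.
Qed.

Section Conditioning.
Variables (v : V) (x : V -> R).
Hypothesis x1 : forall u, `|x u| <= 1.
Local Notation theta := (thinning_par e lambda alpha v).
Local Notation mu := (innovation_par e lambda alpha v).

Definition subtree_factor : R :=
  \prod_(j in ch e v v) (1 - theta j + theta j * tree_eta e v x theta j).

(** The term of the root, which carries the variable of [v], is left out; its part free of that
    variable is the [expR (- lambda v)] of the fiber formula. *)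
Definition offroot_factor : R :=
  expR (\sum_(u | u != v) mu u * (tree_eta e v x theta u - 1)).

Local Notation rho := subtree_factor.
Local Notation C := offroot_factor.

Lemma subtree_factor_norm_le1 : `|rho| <= 1.
Proof.
rewrite normr_prod; apply: prodr_ile1 => j jv; rewrite normr_ge0 convex_norm_le1 //.
  apply: thinning_par_bounds => //; apply: contraTneq jv => ->.
  exact: root_notin_ch.
exact: tree_eta_norm_le1.
Qed.

Lemma log_pgf_linear (y : R) :
  expR (log_pgf e lambda alpha v (fun u => if u == v then y else x u)) =
  C * expR (lambda v * (y * rho - 1)).
Proof.
set x' := fun u => _.
have xE u : u != v -> tree_eta e v x' theta u = tree_eta e v x theta u.
  by apply: tree_eta_root_ext => // w /negPf wv; rewrite /x' wv.
rewrite /log_pgf expRD mulrC; congr (_ * _).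
  by congr expR; apply: eq_bigr => u /xE ->.
rewrite (_ : tree_eta e v x' theta v = y * rho) // tree_eta_rec //.
congr (_ * _); first by rewrite /x' eqxx.
apply: eq_bigr => j jv; rewrite xE //; apply: contraTneq jv => ->.
exact: root_notin_ch.
Qed.

Lemma series_exp_scaled (a c : R) :
  series (fun k => c * (a ^+ k / k`!%:R)) @ \oo --> c * expR a.
Proof.
rewrite (_ : series _ = fun n => c * series (fun k => a ^+ k / k`!%:R) n).
  by apply: cvgMr; exact: series_exp.
by apply/funext => n; rewrite /series /= mulr_sumr.
Qed.

(* Both sides are the coefficients of the same power series in [x v]. *)
Lemma MPMRF_fiber (k : nat) :
  \int[P]_(w in [set w | N v w = k]) \prod_(u | u != v) x u ^+ N u w =
  C * expR (- lambda v) * ((lambda v * rho) ^+ k / k`!%:R).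
Proof.
have l0 := lambda_gt0 adm v.
pose a k := \int[P]_(w in [set w | N v w = k]) \prod_(u | u != v) x u ^+ N u w.
pose b k := C * expR (- lambda v) * ((lambda v * rho) ^+ k / k`!%:R).
have prod_le1 w : `|\prod_(u | u != v) x u ^+ N u w| <= 1.
  exact: norm_prod_Xn_le1.
have pi (A : set T) : measurable A -> P.-integrable A
    (EFin \o (fun w => \prod_(u | u != v) x u ^+ N u w)).
  by move=> mA; exact: integrable_prod_Xn.
have a1 j : `|a j| <= 1.
  rewrite /a Rintegral_mkcond; apply: Rintegral_norm_le1.
    apply/(measurable_restrictT _ (mN v j))/measurable_funTS.
    exact: measurable_prod_Xn.
  by move=> w; rewrite patchE; case: ifP => _ //; rewrite normr0.
(* Coefficients are compared under a uniform bound: [|rho| <= 1] leaves [lambda v ^+ j] over the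
   factorial of [j], a single term of the series of [expR (lambda v)]. *)
have b1 j : `|b j| <= C.
  rewrite /b !normrM (ger0_norm (expR_ge0 _)) (ger0_norm (expR_ge0 _)) -mulrA.
  apply: ler_piMr; first exact: expR_ge0.
  rewrite expRN mulrC ler_pdivrMr ?expR_gt0 // mul1r.
  rewrite normfV (ger0_norm (ler0n _ _)) normrX normrM (gtr0_norm l0).
  apply: (@le_trans _ _ (lambda v ^+ j / j`!%:R)).
    rewrite ler_wpM2r ?invr_ge0 ?ler0n // exprMn; apply: ler_piMr.
      by rewrite exprn_ge0 // ltW.
    by rewrite exprn_ile1 // subtree_factor_norm_le1.
  case: j => [|j]; first by rewrite expr0 fact0 divr1 ltW // expR_gt1.
  by have := expR_ge1Dxn j (ltW l0); lra.
apply/eqP; rewrite -subr_eq0; apply/eqP.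
apply: (@pseries_eq0 _ (fun k => a k - b k) (1 + C)) => [j|y /andP[y0 y1]].
  by apply: le_trans (ler_normB _ _) _; exact: lerD.
have yn : `|y| <= 1 by rewrite ger0_norm ltW.
pose x' u := if u == v then y else x u.
have x'1 u : `|x' u| <= 1 by rewrite /x'; case: ifP.
have cva : series (fun k => a k * y ^+ k) @ \oo --> C * expR (lambda v * (y * rho - 1)).
  rewrite -log_pgf_linear -(MPMRF_pgf v x'1).
  rewrite (_ : (fun k => _) =
    fun k => \int[P]_(w in [set w | N v w = k]) \prod_u x' u ^+ N u w).
    by apply: series_Rintegral => //; exact: integrable_prod_Xn.
  apply/funext => j; rewrite /a mulrC.
  rewrite -RintegralZl; [|exact: mN|by apply: pi; exact: mN].
  apply: eq_Rintegral => w /[!inE] /= Nw.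
  rewrite [\prod_u x' u ^+ _](bigD1 v) //= /x' eqxx Nw.
  by congr (_ * _); apply: eq_bigr => u /negPf ->.
have cvb : series (fun k => b k * y ^+ k) @ \oo --> C * expR (lambda v * (y * rho - 1)).
  rewrite (_ : C * _ = C * expR (- lambda v) * expR (lambda v * rho * y)); last first.
    by rewrite -mulrA -expRD; congr (_ * expR _); ring.
  rewrite (_ : (fun k => _) =
    fun k => C * expR (- lambda v) * ((lambda v * rho * y) ^+ k / k`!%:R)).
    exact: series_exp_scaled.
  by apply/funext => j; rewrite /b (exprMn _ (lambda v * rho) y); ring.
rewrite -(subrr (C * expR (lambda v * (y * rho - 1)))).
rewrite (_ : series _ = series (fun k => a k * y ^+ k) \- series (fun k => b k * y ^+ k)).
  exact: cvgB cva cvb.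
by apply/funext => n; rewrite /series /= -sumrB; apply: eq_bigr => j _; rewrite mulrBl.
Qed.

(** The term-by-term derivative of [expR (c * a)] in [a]. The term of index 0 vanishes through its
    factor [k%:R], so [0.-1 = 0] is harmless, and a shift by one restores the exponential series. *)
Lemma series_exp_deriv (a c : R) : 
  series (fun k => k%:R * a ^+ k.-1 * (c ^+ k / k`!%:R)) @ \oo --> c * expR (c * a).
Proof.
rewrite -(cvg_shiftS (series _)).
rewrite (_ : (fun n => _) = series (fun k => c * ((c * a) ^+ k / k`!%:R))).
  exact: series_exp_scaled.
apply/funext => n; rewrite /series /= big_nat_recl // mul0r mul0r add0r.
apply: eq_bigr => k _; rewrite factS natrM exprMn exprS; field.
by rewrite pnatr_eq0 -lt0n fact_gt0 /= nat1r pnatr_eq0.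
Qed.

End Conditioning.

Lemma integrable_nat_series (U : T -> nat) (l : R) : dmeasurable U ->
  series (fun k => k%:R * fine (P [set w | U w = k])) @ \oo --> l ->
  P.-integrable setT (EFin \o (fun w => (U w)%:R)).
Proof.
move=> mU cvl; apply/integrableP; split.
  by apply/measurable_EFinP; exact: (measurable_dcomp (fun k : nat => k%:R : R)).
rewrite -[X in (\int[P]_(_ in X) _)%E](bigcup_fibers U) ge0_integral_bigcup //.
- rewrite (eq_eseriesr (g := fun k => (k%:R * fine (P [set w | U w = k]))%:E)%E).
    rewrite (_ : limn _ = l%:E) ?ltry //; apply/cvg_lim => //.
    rewrite (_ : (fun n => _) =
      EFin \o series (fun k => k%:R * fine (P [set w | U w = k]))).
      by apply: cvg_EFin; [exact: nearW|exact: cvl].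
    by apply/funext => n; rewrite /series /= sumEFin.
  move=> k _; rewrite -(Rintegral_const_on P (f := fun w => (U w)%:R)) //.
    rewrite EFin_Rintegral //; last by apply: integrable_const_on => // w /= ->.
    by apply: eq_integral => w _ /=; rewrite normr_nat.
  by move=> w /= ->.
- rewrite bigcup_fibers; apply: measurableT_comp => //; apply/measurable_EFinP.
  exact: (measurable_dcomp (fun k : nat => k%:R : R)).
- exact: trivIset_fibers.
Qed.

(** With all variables equal to 1 the fiber formula gives the probabilities of [N v] in Poisson
    shape; the series of [k] times these converges whatever the constants are. *)
Lemma integrable_MPMRF v : P.-integrable setT (EFin \o (fun w => (N v w)%:R)).
Proof.
pose x (_ : V) : R := 1; have x1 u : `|x u| <= 1 by rewrite normr1.
apply: (@integrable_nat_series _ (offroot_factor v x * expR (- lambda v) *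
  (lambda v * subtree_factor v x * expR (lambda v * subtree_factor v x * 1))) (mN v)).
rewrite (_ : series _ = fun n => offroot_factor v x * expR (- lambda v) *
  series (fun k => k%:R * 1 ^+ k.-1 * ((lambda v * subtree_factor v x) ^+ k / k`!%:R)) n).
  by apply: cvgMr; exact: series_exp_deriv.
apply/funext => n; rewrite /series /= mulr_sumr; apply: eq_bigr => k _.
rewrite -[fine _]mul1r -(Rintegral_const_on P (mN v k)
  (f := fun w => \prod_(u | u != v) x u ^+ N u w)).
  by rewrite MPMRF_fiber // expr1n mulr1; ring.
by move=> w _; rewrite big1 // => u _; rewrite expr1n.
Qed.

(** The partial derivative in [x_v] of the generating function at [y], obtained by summing fibers
    instead of differentiating, hence valid up to [|y| = 1]; [N v] dominates the integrand. *)
Lemma MPMRF_deriv v (x : V -> R) (y : R) : (forall u, `|x u| <= 1) -> `|y| <= 1 ->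
  P.-integrable setT (EFin \o (fun w => (N v w)%:R * y ^+ (N v w).-1 *
     \prod_(u | u != v) x u ^+ N u w)) /\
  \int[P]_w ((N v w)%:R * y ^+ (N v w).-1 * \prod_(u | u != v) x u ^+ N u w) =
  lambda v * subtree_factor v x *
    (offroot_factor v x * expR (lambda v * (y * subtree_factor v x - 1))).
Proof.
move=> x1 y1; set f := fun w => _.
have fi : P.-integrable setT (EFin \o f).
  apply: (le_integrable measurableT _ _ (integrable_MPMRF v)).
    apply/measurable_EFinP/measurable_funM; last exact: measurable_prod_Xn.
    exact: (measurable_dcomp (fun k : nat => k%:R * y ^+ k.-1)).
  move=> w _ /=; rewrite lee_fin !normrM -mulrA ler_piMr // mulr_ile1 //.
    by rewrite normrX exprn_ile1.
  exact: norm_prod_Xn_le1.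
split=> //; apply: (cvg_unique _ (series_Rintegral (mN v) fi)) => //=.
rewrite (_ : series _ = fun n => offroot_factor v x * expR (- lambda v) *
  series (fun k => k%:R * y ^+ k.-1 * ((lambda v * subtree_factor v x) ^+ k / k`!%:R)) n).
  rewrite (_ : lambda v * _ * _ = offroot_factor v x * expR (- lambda v) *
    (lambda v * subtree_factor v x * expR (lambda v * subtree_factor v x * y))).
    by apply: cvgMr; exact: series_exp_deriv.
  rewrite (_ : lambda v * (_ - 1) =
    - lambda v + lambda v * subtree_factor v x * y); last ring.
  by rewrite expRD; ring.
apply/funext => n; rewrite /series /= mulr_sumr; apply: eq_bigr => k _.
rewrite mulrCA -MPMRF_fiber // -RintegralZl; [|exact: mN|]; last first.
  by apply: integrable_prod_Xn => //; exact: mN.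
by apply: eq_Rintegral => w /[!inE] /= <-.
Qed.

End MPMRFLaw.

(** * Compound sums and allocations *)

Section RintegralSum.
Context d (T : measurableType d) (R : realType) (P : probability T R).

Lemma Rintegral_sum (I : Type) (s : seq I) (f : I -> T -> R) :
  (forall i, P.-integrable setT (EFin \o f i)) ->
  P.-integrable setT (EFin \o (fun w => \sum_(i <- s) f i w)) /\
  \int[P]_w (\sum_(i <- s) f i w) = \sum_(i <- s) \int[P]_w f i w.
Proof.
move=> fi; elim: s => [|i s [IHi IHe]].
  split; last first.
    rewrite big_nil; under eq_Rintegral do rewrite big_nil.
    by rewrite Rintegral_cst // mul0r.
  rewrite (_ : EFin \o _ = cst 0%E); first exact: integrable0.
  by apply/funext => w /=; rewrite big_nil.
split.
  rewrite (_ : EFin \o _ = ((EFin \o f i) \+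
      (EFin \o (fun w => (\sum_(i <- s) f i w)%R)))%E).
    exact: integrableD.
  by apply/funext => w /=; rewrite big_cons EFinD.
by under eq_Rintegral do rewrite big_cons; rewrite RintegralD // IHe big_cons.
Qed.

End RintegralSum.

Section Compound.
Context (R : realType) d (T : measurableType d) (P : probability T R).
Context (Y : nat -> T -> nat) (t p b : R).
Hypothesis mY : forall j, dmeasurable (Y j).
Hypothesis Y_indep : indep_rvs P setT Y.
Hypothesis t1 : `|t| <= 1.
Hypothesis pE : forall j, \int[P]_w t ^+ Y j w = p.
Hypothesis bi : forall j, P.-integrable setT (EFin \o (fun w => (Y j w)%:R * t ^+ Y j w)).
Hypothesis bE : forall j, \int[P]_w ((Y j w)%:R * t ^+ Y j w) = b.

Lemma iid_sum_pgf m : \int[P]_w t ^+ (\sum_(j < m) Y j w)%N = p ^+ m.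
Proof.
transitivity (\int[P]_w \prod_(0 <= j < m) t ^+ Y j w).
  by apply: eq_Rintegral => w _; rewrite big_mkord expr_sum.
have [_ ->] := @indep_prod _ _ _ P nat setT _ Y (fun _ k => t ^+ k) _ Y_indep
  (iota_uniq 0 (m - 0)) (fun _ _ => I) (fun j _ k => preimage_system_set1 (Y j) k)
  (fun j _ => mY j) (fun j _ => integrable_Xn P t1 (mY j)).
by rewrite big_mkord (eq_bigr (fun=> p)) ?prodr_const ?card_ord.
Qed.

(** When the sum in front is expanded, each of the [m] terms pairs one weighted factor of mean [b]
    with [m.-1] factors of mean [p]. At [m = 0] both sides vanish. *)
Lemma iid_sum_weighted m :
  P.-integrable setT (EFin \o (fun w =>
    ((\sum_(j < m) Y j w)%N)%:R * t ^+ (\sum_(j < m) Y j w)%N)) /\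
  \int[P]_w (((\sum_(j < m) Y j w)%N)%:R * t ^+ (\sum_(j < m) Y j w)%N) =
  m%:R * b * p ^+ m.-1.
Proof.
pose g (i : 'I_m) (j k : nat) : R := (if j == i then k%:R else 1) * t ^+ k.
have gi i : {in index_iota 0 m, forall j,
    P.-integrable setT (EFin \o (fun w => g i j (Y j w)))}.
  move=> j _; rewrite /g; case: (j == i); first exact: bi.
  by under eq_fun do rewrite mul1r; exact: integrable_Xn.
have gE i w : \prod_(0 <= j < m) g i j (Y j w) =
    (Y i w)%:R * t ^+ (\sum_(j < m) Y j w)%N.
  rewrite big_mkord expr_sum big_split /=; congr (_ * _).
  rewrite (bigD1 i) //= eqxx big1 ?mulr1 // => j ji.
  by rewrite ifN // (inj_eq val_inj).
have prodI i := @indep_prod _ _ _ P nat setT _ Y (g i) _ Y_indep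
  (iota_uniq 0 (m - 0)) (fun _ _ => I) (fun j _ k => preimage_system_set1 (Y j) k)
  (fun j _ => mY j) (gi i).
have termi (i : 'I_m) : P.-integrable setT
    (EFin \o (fun w => (Y i w)%:R * t ^+ (\sum_(j < m) Y j w)%N)).
  rewrite (_ : (fun w => _) = fun w => \prod_(0 <= j < m) g i j (Y j w)).
    exact: (prodI i).1.
  by apply/funext => w; rewrite gE.
have termE (i : 'I_m) :
    \int[P]_w ((Y i w)%:R * t ^+ (\sum_(j < m) Y j w)%N) = b * p ^+ m.-1.
  under eq_Rintegral do rewrite -gE.
  rewrite (prodI i).2 big_mkord (bigD1 i) //=; congr (_ * _).
    by under eq_Rintegral do rewrite /g eqxx; exact: bE.
  rewrite (eq_bigr (fun=> p)) => [|j ji].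
    by rewrite prodr_const cardC1 card_ord.
  rewrite -(pE j); apply: eq_Rintegral => w _; rewrite /g.
  by rewrite (inj_eq val_inj) (negPf ji) mul1r.
have sumE : (fun w => ((\sum_(j < m) Y j w)%N)%:R * t ^+ (\sum_(j < m) Y j w)%N) =
    (fun w => \sum_(i < m) (Y i w)%:R * t ^+ (\sum_(j < m) Y j w)%N).
  by apply/funext => w; rewrite natr_sum mulr_suml.
have [si se] := Rintegral_sum (index_enum 'I_m) termi.
rewrite sumE; split=> //; rewrite se (eq_bigr (fun=> b * p ^+ m.-1)) //.
by rewrite sumr_const card_ord -mulrA mulr_natl.
Qed.

End Compound.

Section Allocation.
Context (R : realType) (V : finType) d (T : measurableType d) (P : probability T R).
Context (N : V -> {RV P >-> nat}) (B : V -> {RV P >-> nat}).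
Context (Bs : V -> nat -> {RV P >-> nat}).
Hypothesis B_int : forall v, P.-integrable setT (EFin \o (fun w => (B v w)%:R)).
Hypothesis Bs_law : forall v j, distribution P (Bs v j) =1 distribution P (B v).
Hypothesis Bs_indep : forall v, indep_rvs P setT (fun j => Bs v j : T -> nat).
Hypothesis Bs_N_indep : indep_events P setT
  (fun o : option V =>
     if o is Some v then sigma_rvs setT (fun j => Bs v j : T -> nat)
     else sigma_rvs setT (fun v => N v : T -> nat)).

Let X (v : V) (w : T) : nat := (\sum_(j < N v w) Bs v j w)%N.
Let S (w : T) : nat := (\sum_v X v w)%N.

Let mN v : dmeasurable (N v). Proof. exact/dmeasurable_nat. Qed.
Let mBs v j : dmeasurable (Bs v j). Proof. exact/dmeasurable_nat. Qed.
Let mB v : dmeasurable (B v). Proof. exact/dmeasurable_nat. Qed.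
Let mNN : dmeasurable (fun w => [ffun v => N v w]).
Proof. exact: dmeasurable_finfun. Qed.

Let mX v : dmeasurable (X v).
Proof.
apply: (dmeasurable_glue (U := N v) (f := fun m w => (\sum_(j < m) Bs v j w)%N)) => // m.
exact: dmeasurable_sum.
Qed.

Let mS : dmeasurable S.
Proof. exact: dmeasurable_sum. Qed.

Let law v j (F : nat -> R) : P.-integrable setT (EFin \o (fun w => F (B v w))) ->
  P.-integrable setT (EFin \o (fun w => F (Bs v j w))) /\
  \int[P]_w F (Bs v j w) = \int[P]_w F (B v w).
Proof. by move=> Fi; apply: Rintegral_law => // A; exact: (Bs_law v j A). Qed.

Definition claim_pgf (t : R) v := \int[P]_w t ^+ B v w.
Definition claim_weighted (t : R) v := \int[P]_w ((B v w)%:R * t ^+ B v w).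

Lemma claim_weighted_integrable t v : `|t| <= 1 ->
  P.-integrable setT (EFin \o (fun w => (B v w)%:R * t ^+ B v w)).
Proof.
move=> t1; apply: (le_integrable measurableT _ _ (B_int v)).
  apply/measurable_EFinP.
  exact: (measurable_dcomp (fun k : nat => k%:R * t ^+ k : R)).
move=> w _ /=; rewrite lee_fin normrM ler_piMr // normrX exprn_ile1 //.
Qed.

Let X_ (n : {ffun V -> nat}) v w := (\sum_(j < n v) Bs v j w)%N.

(** On the event that [N] equals [n], [X v] is [X_ n v], a sum with a fixed number of terms that
    depends on the claims alone; these are independent across vertices and of [N]. *)
Lemma condition_claims (n : {ffun V -> nat}) (g : V -> nat -> R) :
  (forall v, P.-integrable setT (EFin \o (fun w => g v (X_ n v w)))) ->
  P.-integrable [set w | [ffun v => N v w] = n]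
    (EFin \o (fun w => \prod_v g v (X v w))) /\
  \int[P]_(w in [set w | [ffun v => N v w] = n]) \prod_v g v (X v w) =
  \int[P]_(w in [set w | [ffun v => N v w] = n]) \prod_v \int[P]_w' g v (X_ n v w').
Proof.
move=> gi.
pose Y (o : option V) := if o is Some v then X_ n v else fun=> 0%N.
pose h (o : option V) k : R := if o is Some v then g v k else 1.
pose s1 := [seq Some v | v <- index_enum V].
have us : uniq (s1 ++ [:: None]).
  have Some_inj : injective (@Some V) by move=> u v [].
  rewrite cat_uniq (map_inj_uniq Some_inj) index_enum_uniq /= orbF andbT.
  by apply/negP => /mapP[].
have mY o : dmeasurable (Y o).
  case: o => [v|]; first exact: dmeasurable_sum.
  by apply/dmeasurable_nat; exact: measurable_cst.
have FY : {in s1, forall o k,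
    (if o is Some v then sigma_rvs setT (fun j => Bs v j : T -> nat)
     else sigma_rvs setT (fun v => N v : T -> nat)) [set w | Y o w = k]}.
  move=> [v|] os k; last by case/mapP: os.
  apply: (@dmeasurable_sum _ (g_sigma_algebraType (\bigcup_(j in setT)
    preimage_set_system setT (Bs v j : T -> nat) measurable)) _ _
    (fun (j : 'I_(n v)) => Bs v j : T -> nat)) => j.
  exact: (@sigma_rvs_dmeasurable _ T _ nat nat setT (fun j => Bs v j : T -> nat) j).
have hi : {in s1, forall o, P.-integrable setT (EFin \o (fun w => h o (Y o w)))}.
  by move=> [v|] os; [exact: gi|case/mapP: os].
have FA : {in [:: None : option V], forall o,
    (if o is Some v then sigma_rvs setT (fun j => Bs v j : T -> nat)
     else sigma_rvs setT (fun v => N v : T -> nat))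
    [set w | [ffun v => N v w] = n]}.
  move=> o; rewrite inE => /eqP ->.
  apply: (@dmeasurable_finfun _ (g_sigma_algebraType (\bigcup_(v in setT)
    preimage_set_system setT (N v : T -> nat) measurable)) V nat
    (fun v => N v : T -> nat)) => v.
  exact: sigma_rvs_dmeasurable.
have [] := @indep_prod_setI _ _ _ P _ _ _ Y h
  s1 [:: None] (fun=> [set w | [ffun v => N v w] = n]) Bs_N_indep us
  (fun _ _ => I) FY (fun o _ => mY o) hi FA (fun _ _ => mNN n).
rewrite big_seq1 big_map /=.
rewrite (_ : \bigcap_(i in _) _ = [set w | [ffun v => N v w] = n]); last first.
  apply/seteqP; split=> w; last by move=> Nw i _.
  by move/(_ None); apply; rewrite /= inE.
have hE w : [set w | [ffun v => N v w] = n] w ->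
    \prod_(i <- s1) h i (Y i w) = \prod_v g v (X v w).
  move=> /= Nw; rewrite big_map; apply: eq_bigr => v _ /=.
  by rewrite /X_ -Nw ffunE.
move=> int1 eq1; split.
  apply: (eq_integrable (mNN n) (EFin \o (fun w => \prod_(i <- s1) h i (Y i w)))) => //.
  by move=> w /[!inE] /hE /= ->.
rewrite Rintegral_cst; last exact: mNN.
by rewrite -eq1; apply: eq_Rintegral => w /[!inE] /hE.
Qed.

Lemma aggregate_pgf t : `|t| <= 1 ->
  \int[P]_w t ^+ S w = \int[P]_w \prod_v claim_pgf t v ^+ N v w.
Proof.
move=> t1; have p1 v : `|claim_pgf t v| <= 1.
  apply: Rintegral_norm_le1; first exact: measurable_Xn.
  by move=> w; rewrite normrX exprn_ile1.
apply: (eq_Rintegral_fibers mNN) => [||n].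
- exact: integrable_Xn.
- exact: integrable_prod_Xn.
have [|_ eq1] := @condition_claims n (fun _ k => t ^+ k).
  by move=> v; apply: integrable_Xn => //; exact: dmeasurable_sum.
transitivity (\int[P]_(w in [set w | [ffun v => N v w] = n]) \prod_v t ^+ X v w).
  by apply: eq_Rintegral => w _; rewrite /S expr_sum.
rewrite eq1; apply: eq_Rintegral => w /[!inE] /= Nw; apply: eq_bigr => v _.
have pE j : \int[P]_w' t ^+ Bs v j w' = claim_pgf t v.
  by rewrite (@law v j (fun k => t ^+ k) (integrable_Xn P t1 (@mB v))).2.
by rewrite (iid_sum_pgf (@mBs v) (@Bs_indep v) t1 pE) -Nw ffunE.
Qed.

(** Only the factor of [v] is weighted. Integrability is asserted on each fiber; over the whole
    space it also takes control of the sum over [n], for which this identity is used again at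
    [|t|]. *)
Lemma allocation_fiber t v (n : {ffun V -> nat}) : `|t| <= 1 ->
  P.-integrable [set w | [ffun v => N v w] = n]
    (EFin \o (fun w => (X v w)%:R * t ^+ S w)) /\
  \int[P]_(w in [set w | [ffun v => N v w] = n]) ((X v w)%:R * t ^+ S w) =
  \int[P]_(w in [set w | [ffun v => N v w] = n])
    (claim_weighted t v * ((N v w)%:R * claim_pgf t v ^+ (N v w).-1 *
      \prod_(u | u != v) claim_pgf t u ^+ N u w)).
Proof.
move=> t1; pose g u k : R := (if u == v then k%:R else 1) * t ^+ k.
have powE u j : \int[P]_w t ^+ Bs u j w = claim_pgf t u.
  by rewrite (@law u j (fun k => t ^+ k) (integrable_Xn P t1 (@mB u))).2.
have wE u j := @law u j (fun k => k%:R * t ^+ k) (claim_weighted_integrable u t1).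
have iidw u m := iid_sum_weighted (@mBs u) (@Bs_indep u) t1 (powE u)
  (fun j => (wE u j).1) (fun j => (wE u j).2) m.
have gi u : P.-integrable setT (EFin \o (fun w => g u (X_ n u w))).
  rewrite /g; case: (u == v); first exact: (iidw u (n u)).1.
  under eq_fun do rewrite mul1r.
  by apply: integrable_Xn => //; exact: dmeasurable_sum.
have gE : (fun w => \prod_u g u (X u w)) = (fun w => (X v w)%:R * t ^+ S w).
  apply/funext => w; rewrite big_split /= /S expr_sum; congr (_ * _).
  by rewrite (bigD1 v) //= eqxx big1 ?mulr1 // => u /negPf ->.
have [] := condition_claims gi; rewrite gE => int1 eq1; split=> //.
rewrite eq1; apply: eq_Rintegral => w /[!inE] /= Nw.
rewrite (bigD1 v) //= !mulrA; congr (_ * _).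
  under eq_Rintegral do rewrite /g eqxx.
  rewrite (iidw v (n v)).2 -Nw ffunE /claim_weighted.
  by rewrite [_ * (N v w)%:R]mulrC.
apply: eq_bigr => u /negPf uv; rewrite /g uv; under eq_Rintegral do rewrite mul1r.
by rewrite (iid_sum_pgf (@mBs u) (@Bs_indep u) t1 (powE u)) -Nw ffunE.
Qed.

(** Where [S w = k] the factor [t ^+ k] is [t ^+ S w], so the partial sums add up integrals of one
    function over the fibers of [S]. *)
Lemma expected_alloc_series v t : `|t| <= 1 ->
  P.-integrable setT (EFin \o (fun w => (X v w)%:R)) ->
  P.-integrable setT (EFin \o (fun w => (X v w)%:R * t ^+ S w)) ->
  eseries (fun k => expected_alloc P (X v) S k * (t ^+ k)%:E)%E @ \oo -->
    (\int[P]_w ((X v w)%:R * t ^+ S w))%:E.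
Proof.
move=> t1 Xi fi.
rewrite (_ : eseries _ = EFin \o series (fun k =>
    \int[P]_(w in [set w | S w = k]) ((X v w)%:R * t ^+ S w))).
  by apply: cvg_EFin; [exact: nearW|exact: series_Rintegral].
apply/funext => n; rewrite /eseries /series /= -sumEFin; apply: eq_bigr => k _.
have XSi : P.-integrable [set w | S w = k] (EFin \o (fun w => (X v w)%:R)).
  by apply: integrableS Xi => //; exact: mS.
rewrite (_ : expected_alloc _ _ _ _ =
    (\int[P]_(w in [set w | S w = k]) (X v w)%:R)%:E).
  rewrite -EFinM -RintegralZr //.
  by congr EFin; apply: eq_Rintegral => w /[!inE] /= ->.
rewrite EFin_Rintegral //.
rewrite /expected_alloc unlock [RHS]integral_mkcond; apply: eq_integral => w _.
rewrite patchE indicE.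
by case: ifP => _; rewrite ?mulr1 ?mulr0.
Qed.

End Allocation.

Theorem theorem4p2 (R : realType) (d : nat) (e : rel 'I_d)
    (lambda : 'I_d -> R) (alpha : 'I_d -> 'I_d -> R)
    (disp : measure_display) (T : measurableType disp) (P : probability T R)
    (N : 'I_d -> {RV P >-> nat})
    (B : 'I_d -> {RV P >-> nat}) (Bs : 'I_d -> nat -> {RV P >-> nat})
    (tree_e : is_tree e)
    (adm : admissible e lambda alpha)
    (N_law : MPMRF e lambda alpha P (fun v => N v : T -> nat))
    (B_mean : forall v, (0 < mean P (B v) < +oo)%E)
    (Bs_law : forall v j, distribution P (Bs v j) =1 distribution P (B v))
    (Bs_indep : forall v, indep_rvs P setT (fun j => Bs v j : T -> nat))
    (Bs_N_indep : indep_events P setT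
       (fun o : option 'I_d =>
          if o is Some v then sigma_rvs setT (fun j => Bs v j : T -> nat)
          else sigma_rvs setT (fun v => N v : T -> nat))) :
  let X (v : 'I_d) (w : T) : nat := (\sum_(j < N v w) Bs v j w)%N in
  let S (w : T) : nat := (\sum_v X v w)%N in
  forall (v : 'I_d) (t : R), -1 <= t <= 1 ->
  let s (j : 'I_d) : R :=
    if j == v then pgf_tderiv P (B v) t / fine (mean P (B v))
    else pgf P (B j) t in
  let theta (k : 'I_d) : R := thinning_par e lambda alpha v k in
  eseries (fun k : nat => (expected_alloc P (X v) S k * (t ^+ k)%:E)%E) @ \oo -->
    (lambda v * fine (mean P (B v)) * tree_eta e v s theta v * pgf P S t)%:E.
Proof.
move=> X S v t; rewrite -ler_norml => t1 s theta.
have B_int u : P.-integrable setT (EFin \o (fun w => (B u w)%:R)).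
  apply/integrableP; split.
    apply/measurable_EFinP; apply: (measurable_dcomp (fun k : nat => k%:R : R)).
    exact/dmeasurable_nat.
  have /andP[_] := B_mean u; rewrite /mean unlock; apply: le_lt_trans.
  rewrite le_eqVlt; apply/orP; left; apply/eqP/eq_integral => w _ /=.
  by rewrite normr_nat.
have mNN : dmeasurable (fun w => [ffun u => N u w]).
  by apply: dmeasurable_finfun => u; exact/dmeasurable_nat.
have mX u : dmeasurable (X u).
  apply: (dmeasurable_glue (U := N u) (f := fun m w => (\sum_(j < m) Bs u j w)%N)).
    exact/dmeasurable_nat.
  by move=> m; apply: dmeasurable_sum => j; exact/dmeasurable_nat.
have mS : dmeasurable S by exact: dmeasurable_sum.
have pgf1 y u : `|y| <= 1 -> `|claim_pgf B y u| <= 1.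
  move=> y1; apply: Rintegral_norm_le1.
    by apply: measurable_Xn; exact/dmeasurable_nat.
  by move=> w; rewrite normrX exprn_ile1.
(* Proved for every [|y| <= 1] because it serves twice: at [t], and at 1, where it yields the
   integrability of [X v]. *)
have alloc y : `|y| <= 1 ->
    P.-integrable setT (EFin \o (fun w => (X v w)%:R * y ^+ S w)) /\
    \int[P]_w ((X v w)%:R * y ^+ S w) = claim_weighted B y v *
      (lambda v * subtree_factor e lambda alpha v (claim_pgf B y) *
       \int[P]_w y ^+ S w).
  move=> y1.
  have dE z : `|z| <= 1 -> _ := fun z1 => MPMRF_deriv tree_e adm N_law v
    (fun u => pgf1 z u z1) (pgf1 z v z1).
  (* The absolute value of [X_v * y ^ S] is the same expression at [|y|], whose fiber integrals are
     known; this supplies the integrable comparison function for conditioning on [N]. *)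
  have ny1 : `| `|y| | <= 1 by rewrite normr_id.
  have Zi c (f : T -> R) : P.-integrable setT (EFin \o f) ->
      P.-integrable setT (EFin \o (fun w => c * f w)).
    move=> fi; rewrite (_ : EFin \o _ = fun w => (c%:E * (f w)%:E)%E) //.
    exact: integrableZl.
  have fibE z n := allocation_fiber B_int Bs_law Bs_indep Bs_N_indep v n (t := z).
  have mf : measurable_fun setT (fun w => (X v w)%:R * y ^+ S w).
    apply: measurable_funM; last exact: measurable_Xn.
    exact: (measurable_dcomp (fun k : nat => k%:R : R)).
  have [] := cond_Rintegral mNN mf (Zi (claim_weighted B y v) _ (dE y y1).1)
    (Zi (claim_weighted B `|y| v) _ (dE _ ny1).1).
  - by move=> n; exact: (fibE y n y1).1.
  - by move=> n; exact: (fibE y n y1).2.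
  - move=> n; rewrite -(fibE _ n ny1).2; apply: eq_Rintegral => w _.
    by rewrite normrM normr_nat normrX.
  move=> int1 eq1; split=> //; rewrite eq1 RintegralZl //; last exact: (dE y y1).1.
  congr (_ * _); rewrite (dE y y1).2; congr (_ * _).
  rewrite (aggregate_pgf Bs_law Bs_indep Bs_N_indep y1).
  rewrite (MPMRF_pgf tree_e adm N_law v) => [|u]; last exact: pgf1.
  rewrite -(log_pgf_linear tree_e lambda alpha v (claim_pgf B y)).
  by congr (expR (log_pgf _ _ _ _ _)); apply/funext => u; case: eqP => [->|].
have X_int : P.-integrable setT (EFin \o (fun w => (X v w)%:R)).
  have [] := alloc 1; first by rewrite normr1.
  by under eq_fun do rewrite expr1n mulr1.
have [Xt_int allocE] := alloc t t1.
have := expected_alloc_series t1 X_int Xt_int; rewrite allocE.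
rewrite (_ : claim_weighted B t v * _ = lambda v * fine (mean P (B v)) *
  tree_eta e v s theta v * pgf P S t) //.
have mean0 : fine (mean P (B v)) != 0.
  have /andP[m0 moo] := B_mean v; rewrite gt_eqF // -lte_fin fineK //.
  by rewrite ge0_fin_numE // ltW.
(* The variable of the root contributes [claim_weighted] over the mean of [B v], and this mean
   cancels with the one in front; below the root [s] coincides with [claim_pgf]. *)
rewrite tree_eta_rec // {1}/s eqxx.
rewrite (_ : \prod_(j in ch e v v) _ =
    subtree_factor e lambda alpha v (claim_pgf B t)); last first.
  apply: eq_bigr => j jv; congr (_ + _ * _).
  apply: (tree_eta_root_ext tree_e) => [u uv|].
    by rewrite /s (negPf uv) /pgf unlock.
  by apply: contraTneq jv => ->; exact: root_notin_ch.
rewrite (_ : pgf_tderiv P (B v) t = claim_weighted B t v); last first.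
  apply/cvg_lim => //.
  rewrite (_ : (fun k => _) = fun k => (k%:R * t ^+ k) * fine (P [set w | B v w = k])).
    apply: (series_Rintegral_comp (g := fun k => k%:R * t ^+ k)).
      exact/dmeasurable_nat.
    exact: claim_weighted_integrable.
  by apply/funext => k; rewrite mulrAC.
rewrite (_ : pgf P S t = \int[P]_w t ^+ S w); last by rewrite /pgf unlock.
by field.
Qed.
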